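(* For any $\alpha>0$ there exist an integer $\ell_0>0$ and $n_0$ such that the following holds for any integer $\ell\ge3$ and $n\ge n_0$. Suppose $p=\omega(p_{\ell_0,\ell}(n))$, $G$ is an $(n,p,\ell_0,\ell)$-graph, and $G_\alpha$ is an $n$-vertex graph on the same vertex set as $G$ with $\delta(G_\alpha)\ge\alpha n$. Then $H:=G_\alpha\cup G$ is $\mathcal{F}^\ell(n,2)$-universal.
   Context: Define $p_{\ell_0,\ell}(n)=n^{-(\ell-1)/\ell}$ if $\ell<\ell_0$ and $p_{\ell_0,\ell}(n)=n^{-1}$ if $\ell\ge\ell_0$. For a graph $T$ with vertices labelled $v_1,\dots,v_t$ (a fixed labelling, chosen arbitrarily if none is specified), a graph $G$ and sets $V_1,\dots,V_t\subseteq V(G)$, let $t_T(G)$ be the number of copies of $T$ in $G$ and $t_T(V_1,\dots,V_t)$ the number of copies of $T$ in $G$ in which the copy of $v_i$ lies in $V_i$ for all $i$. $K_{1,2}$ is the cherry (path with two edges), $C_k$ the cycle of length $k$. For integers $\ell_0>0$, $\ell\ge3$ and $p\in(0,1)$, an $n$-vertex graph $G$ is an $(n,p,\ell_0,\ell)$-graph if: (A1) for any disjoint $V_1,V_2\subset V(G)$ with $|V_1|,|V_2|\ge n/\ell_0$, $t_{K_2}(V_1,V_2)\ge (p/2)|V_1||V_2|$; (A2) for any pairwise disjoint $V_1,V_2,V_3\subset V(G)$ with $|V_i|\ge n/\ell_0$, $t_{K_{1,2}}(V_1,V_2,V_3)\ge (p^2/4)|V_1||V_2||V_3|$; furthermore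 $t_{K_{1,2}}(G)\le p^2n^3$; (A3) for all $k$ with $\ell\le k<\ell_0$ and any pairwise disjoint $V_1,\dots,V_k\subseteq V(G)$ with $|V_i|\ge n/\ell_0^2$, $t_{C_k}(V_1,\dots,V_k)\ge \tfrac12 p^k\prod_{i=1}^k|V_i|$; furthermore, for $k=3,4$, $t_{C_k}(G)\le p^kn^k$. $\mathcal{F}^\ell(n,2)$ is the family of all $n$-vertex graphs with maximum degree at most $2$ and girth at least $\ell$. A graph is $\mathcal{F}$-universal if it contains every member of $\mathcal{F}$ as a (not necessarily induced) subgraph. *)

(* Defs.v *)
From mathcomp Require Import all_boot all_order all_algebra.
From mathcomp Require Import all_classical all_reals all_analysis.

Set Implicit Arguments.
Unset Strict Implicit.
Unset Printing Implicit Defensive.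

Import Order.TTheory GRing.Theory Num.Theory.
Import numFieldNormedType.Exports.

Local Open Scope ring_scope.

Record sgraph (V : finType) := SGraph {
  adj :> rel V;
  adj_sym : symmetric adj;
  adj_irr : irreflexive adj }.

Section Graphs.
Variable V : finType.
Implicit Types G : sgraph V.

Definition degree G (x : V) : nat := #|[set y | G x y]|.

Definition max_degree G : nat := \max_(x : V) degree G x.

(* The default value #|V| only matters when V is empty: every degree is
   smaller than #|V|. *)
Definition min_degree G : nat := \big[minn/#|V|]_(x : V) degree G x.

Fact union_sym G1 G2 : symmetric (fun x y => G1 x y || G2 x y).
Proof. by move=> x y; rewrite !(adj_sym _ x). Qed.

Fact union_irr G1 G2 : irreflexive (fun x y => G1 x y || G2 x y).
Proof. by move=> x; rewrite !adj_irr. Qed.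

Definition gunion G1 G2 : sgraph V :=
  SGraph (union_sym G1 G2) (union_irr G1 G2).

End Graphs.

Definition embedding (W V : finType) (T : sgraph W) (G : sgraph V)
    (f : {ffun W -> V}) : bool :=
  injectiveb f && [forall x, forall y, T x y ==> G (f x) (f y)].

Definition contains (W V : finType) (G : sgraph V) (T : sgraph W) : Prop :=
  exists f : {ffun W -> V}, embedding T G f.

(* The subgraph (vertex set, edge set) that an embedding of T traces out.
   Embeddings differing by an automorphism of T give the same copy. *)
Definition copy (W V : finType) (T : sgraph W) (f : {ffun W -> V}) :
    {set V} * {set {set V}} :=
  ([set f x | x : W], [set [set f e.1; f e.2] | e : W * W & T e.1 e.2]).

Definition ncopies_in (W V : finType) (T : sgraph W) (G : sgraph V)
    (Vs : W -> {set V}) : nat :=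
  #|[set copy T f | f : {ffun W -> V} &
       embedding T G f && [forall x, f x \in Vs x]]|.

Definition ncopies (W V : finType) (T : sgraph W) (G : sgraph V) : nat :=
  #|[set copy T f | f : {ffun W -> V} & embedding T G f]|.

Fact edge_sym : symmetric (fun i j : 'I_2 => i != j).
Proof. by move=> i j; rewrite eq_sym. Qed.
Fact edge_irr : irreflexive (fun i j : 'I_2 => i != j).
Proof. by move=> i; rewrite eqxx. Qed.
Definition edge_graph : sgraph 'I_2 := SGraph edge_sym edge_irr.

(* K_{1,2}, with centre 0 *)
Fact cherry_sym : symmetric (fun i j : 'I_3 => (i == ord0) (+) (j == ord0)).
Proof. by move=> i j; rewrite addbC. Qed.
Fact cherry_irr : irreflexive (fun i j : 'I_3 => (i == ord0) (+) (j == ord0)).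
Proof. by move=> i; rewrite addbb. Qed.
Definition cherry : sgraph 'I_3 := SGraph cherry_sym cherry_irr.

(* C_k, meaningful for k >= 3; ordS is the cyclic successor *)
Definition cycle_rel (k : nat) : rel 'I_k :=
  fun i j => (i != j) && ((j == ordS i) || (i == ordS j)).
Fact cycle_sym k : symmetric (@cycle_rel k).
Proof. by move=> i j; rewrite /cycle_rel eq_sym orbC. Qed.
Fact cycle_irr k : irreflexive (@cycle_rel k).
Proof. by move=> i; rewrite /cycle_rel eqxx. Qed.
Definition cycle_graph (k : nat) : sgraph 'I_k :=
  SGraph (@cycle_sym k) (@cycle_irr k).

(* Acyclic graphs have infinite girth, hence the implication. *)
Definition girth_at_least (V : finType) (G : sgraph V) (l : nat) : Prop :=
  forall k, (3 <= k)%N -> contains G (cycle_graph k) -> (l <= k)%N.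

(* F is a member of F^l(n, 2) *)
Definition in_family (l n : nat) (W : finType) (F : sgraph W) : Prop :=
  [/\ #|W| = n, (max_degree F <= 2)%N & girth_at_least F l].

Definition family_universal (l n : nat) (V : finType) (H : sgraph V) : Prop :=
  forall (W : finType) (F : sgraph W), in_family l n F -> contains H F.

Definition pairwise_disjoint (I V : finType) (Vs : I -> {set V}) : Prop :=
  forall i j, i != j -> [disjoint Vs i & Vs j].

Section PseudorandomGraphs.
Variable R : realType.

Definition p_threshold (l0 l n : nat) : R :=
  if (l < l0)%N then n%:R `^ (- ((l%:R - 1) / l%:R)) else n%:R^-1.

(* f = omega(g) *)
Definition little_omega (f g : nat -> R) : Prop :=
  ((fun n => f n / g n) @ \oo --> +oo)%classic.

Variables (n : nat) (p : R) (l0 l : nat) (V : finType) (G : sgraph V).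

Definition axiomA1 : Prop :=
  forall Vs : 'I_2 -> {set V}, pairwise_disjoint Vs ->
    (forall i, n%:R / l0%:R <= #|Vs i|%:R :> R) ->
    p / 2 * \prod_i #|Vs i|%:R <= (ncopies_in edge_graph G Vs)%:R.

Definition axiomA2 : Prop :=
  (forall Vs : 'I_3 -> {set V}, pairwise_disjoint Vs ->
     (forall i, n%:R / l0%:R <= #|Vs i|%:R :> R) ->
     p ^+ 2 / 4 * \prod_i #|Vs i|%:R <= (ncopies_in cherry G Vs)%:R)
  /\ (ncopies cherry G)%:R <= p ^+ 2 * n%:R ^+ 3.

Definition axiomA3 : Prop :=
  (forall k, (l <= k < l0)%N ->
     forall Vs : 'I_k -> {set V}, pairwise_disjoint Vs ->
       (forall i, n%:R / l0%:R ^+ 2 <= #|Vs i|%:R :> R) ->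
       1 / 2 * p ^+ k * \prod_i #|Vs i|%:R
         <= (ncopies_in (cycle_graph k) G Vs)%:R)
  /\ (forall k, k = 3%N \/ k = 4%N ->
       (ncopies (cycle_graph k) G)%:R <= p ^+ k * n%:R ^+ k).

Definition npl_graph : Prop :=
  [/\ 0 < p < 1, #|V| = n, axiomA1, axiomA2 & axiomA3].

End PseudorandomGraphs.

(* Main.v *)
(* A bijection f from F onto the vertices of the host which breaks only few edges
   of F can be repaired (repair_step) as soon as for all vertices v, y there are
   linearly many w in F with f w in N_alpha(y) and with the images of all
   F-neighbours of w in N_alpha(v).  For a broken edge uw, let u', w' be the
   other neighbours of u, w.  Exchange f u with some f w1, where w1 serves the
   pair (f u, f u'), and f w with some f w2, where w2 serves (f w, f w'), in such
   a way that f w1 and f w2 are adjacent in G; this is possible by (A1).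

   To get such an f, cut F into cycles shorter than l0 and blocks of bounded
   length, spoiling few edges.  At least a constant fraction of the vertices
   lies in triangles, in 4-cycles, or in longer pieces.  In each case disjoint
   triangles, 4-cycles or cherries of G serving every pair (v, y) linearly often
   are chosen one by one by multiplicative weights: give a pair the weight 2^-k
   when it has been served k times; by the lower and upper bounds on the number
   of copies, some free copy serves a constant fraction of the total weight.
   Cherries are completed to longer pieces through N_alpha and (A1).  The other
   pieces are embedded greedily, by (A3) and (A1), until few vertices remain. *)

Require Import Defs.
From mathcomp Require Import all_boot all_order all_algebra.
From mathcomp Require Import all_classical all_reals all_analysis.
From mathcomp Require Import fintype finset zify lra ring.

Set Implicit Arguments.
Unset Strict Implicit.
Unset Printing Implicit Defensive.

Import Order.TTheory GRing.Theory Num.Theory.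
Local Open Scope nat_scope.

(** * Decomposition of a graph of maximum degree two *)

Section Pieces.
Variable W : finType.
Implicit Types (p O : seq W) (P : seq (seq W)).

Lemma infix_cat_cons p x y : infix [:: x; y] p <-> exists p1 p2, p = p1 ++ x :: y :: p2.
Proof. by split=> [/infixP[p1 [p2 ->]]|[p1 [p2 ->]]]; [exists p1, p2|apply/infixP; exists p1, p2]. Qed.

Lemma next_infix p x y : uniq p -> infix [:: x; y] p -> next p x = y.
Proof.
move=> up /infix_cat_cons[p1 [p2 Ep]].
have xp : x \in p by rewrite Ep mem_cat inE eqxx orbT.
rewrite next_nth xp; move: up; rewrite Ep; case: p1 {Ep} => [|z p1] /=.
  by rewrite eqxx.
move=> /andP[zp up]; have zx : z != x.
  by apply: contraNneq zp => ->; rewrite mem_cat inE eqxx orbT.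
rewrite (negPf zx) /= index_cat.
move: up; rewrite cat_uniq => /and3P[_ /hasPn xp1 _].
have /negPf -> : x \notin p1 by apply: xp1; rewrite inE eqxx.
by rewrite /= eqxx addn0 nth_cat ltnNge leqnSn /= subSnn.
Qed.

Lemma next_last x0 p : uniq p -> p != [::] -> next p (last x0 p) = head x0 p.
Proof.
case/lastP: p => // p a up _; rewrite next_nth last_rcons mem_rcons inE eqxx /=.
case: p up => [|b p] up /=; first by rewrite eqxx.
have -> : (if b == a then 0 else (index a (rcons p a)).+1) = (size p).+1.
  have h : (size p).+1 < size (b :: rcons p a) by rewrite /= size_rcons.
  by have := index_uniq a h up; rewrite /= nth_rcons ltnn eqxx.
by rewrite nth_default // size_rcons.
Qed.

Lemma infix_flatten P p x y : p \in P -> infix [:: x; y] p ->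
  infix [:: x; y] (flatten P).
Proof.
move=> /splitPr[P1 P2] /infix_cat_cons[p1 [p2 ->]].
apply/infix_cat_cons; exists (flatten P1 ++ p1), (p2 ++ flatten P2).
by rewrite flatten_cat /= -!catA.
Qed.

Lemma infix_nth x0 p i : i.+1 < size p -> infix [:: nth x0 p i; nth x0 p i.+1] p.
Proof.
move=> ip; apply/infix_cat_cons; exists (take i p), (drop i.+2 p).
by rewrite -!drop_nth ?cat_take_drop // ltnW.
Qed.

Lemma infix_mem p x y : infix [:: x; y] p -> x \in p /\ y \in p.
Proof. by move=> /mem_infix h; split; apply: h; rewrite !inE eqxx ?orbT. Qed.

Lemma mem_not_last x0 p x : x \in p -> x != last x0 p -> exists z, infix [:: x; z] p.
Proof.
move=> xp xl; exists (nth x0 p (index x p).+1).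
suff h : (index x p).+1 < size p by have := infix_nth x0 h; rewrite nth_index.
move: xp xl; rewrite -index_mem => ip; rewrite -nth_last => xl.
rewrite ltn_neqAle ip andbT; apply: contraNneq xl => <-.
by rewrite nth_index // -index_mem.
Qed.

Lemma mem_not_head x0 p x : x \in p -> x != head x0 p -> exists z, infix [:: z; x] p.
Proof.
case: p => // a p; rewrite inE => /predU1P[->|xp] /= xa; first by rewrite eqxx in xa.
exists (nth x0 (a :: p) (index x p)).
have Ex : nth x0 (a :: p) (index x p).+1 = x by rewrite /= nth_index.
have h : (index x p).+1 < size (a :: p) by rewrite /= ltnS index_mem.
by have := infix_nth x0 h; rewrite Ex.
Qed.

(** An interior entry of a block has both its neighbours in the concatenation inside the block,
    since [next] of the block and [next] of [flatten P] agree on consecutive entries. So cutting a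
    long list into blocks does harm only at block ends. *)
Lemma infix_block x0 P p x y : uniq (flatten P) -> p \in P -> x \in p ->
  x != head x0 p -> x != last x0 p ->
  infix [:: x; y] (flatten P) \/ infix [:: y; x] (flatten P) ->
  y = next p x \/ x = next p y.
Proof.
move=> uP pP xp xh xl.
have up : uniq p.
  by case/splitPr: pP uP => P1 P2; rewrite flatten_cat /= !cat_uniq => /and3P[_ _ /and3P[]].
case=> h.
  have [z xz] := mem_not_last xp xl; left.
  by rewrite (next_infix up xz) -(next_infix uP h) (next_infix uP (infix_flatten pP xz)).
have [z xz] := mem_not_head xp xh; right.
rewrite -(prev_next uP y) (next_infix uP h) -(next_infix uP (infix_flatten pP xz)) prev_next //.
by rewrite (next_infix up xz) (next_infix uP (infix_flatten pP xz)).
Qed.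

Lemma cut_blocks s O : 0 < s -> exists P r,
  [/\ O = flatten P ++ r, all (fun p => size p == s) P & size r < s].
Proof.
move=> s0; have [n nO] := ubnP (size O); elim: n O nO => // n IH O nO.
have [Os|sO] := ltnP (size O) s; first by exists [::], O.
have [|P [r [E aP rs]]] := IH (drop s O); first by rewrite size_drop; lia.
exists (take s O :: P), r; split=> //=; first by rewrite -catA -E cat_take_drop.
by rewrite size_take_min aP andbT; apply/eqP; lia.
Qed.

End Pieces.

(** * Components as vertex lists of paths and cycles *)

Section Decomposition.
Variables (W : finType) (F : sgraph W).
Hypothesis Fdeg : max_degree F <= 2.

Lemma no_three_nbrs x a b c : F x a -> F x b -> F x c -> uniq [:: a; b; c] -> False.
Proof.
move=> xa xb xc u.
have : degree F x <= 2 by apply: leq_trans Fdeg; exact: (leq_bigmax x).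
suff : 3 <= degree F x by rewrite ltnNge => /negP.
have -> : 3 = #|[:: a; b; c]| by apply/esym/eqP; move/card_uniqP: u => ->.
by apply/subset_leq_card/subsetP => z; rewrite !inE => /or3P[] /eqP ->.
Qed.

Definition is_cycle (p : seq W) : bool := (3 <= size p) && cycle F p.

(** Every edge of [F] at a vertex of [p] joins consecutive entries or closes [p] to a cycle.
    Consecutive entries are not asked to be adjacent: only the edges of [F] have to be preserved
    later. The argument [x0] is the default for [head] and [last]. *)
Definition piece (p : seq W) : Prop :=
  forall x0 x y, x \in p -> F x y ->
    [\/ infix [:: x; y] p, infix [:: y; x] p |
        is_cycle p /\ (x = head x0 p /\ y = last x0 p \/ x = last x0 p /\ y = head x0 p)].

(** A longest path of [F] inside [S] is taken. Its interior vertices already have two neighbours on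
    it, and by maximality its ends have no neighbour off it; hence any further edge joins the two
    ends. *)
Lemma piece_exists (S : {set W}) : S != finset.set0 ->
  (forall x y, x \in S -> F x y -> y \in S) ->
  exists p, [/\ p != [::], uniq p, {subset p <= S} & piece p].
Proof.
move=> /set0Pn[x0 x0S] Scl.
pose Q n := [exists t : n.-tuple W, [&& uniq t, sorted F t & all (mem S) t]].
have exQ : exists n, Q n by exists 1; apply/existsP; exists [tuple x0]; rewrite /= andbT.
have Qle n : Q n -> n <= #|W|.
  by case/existsP => t /and3P[/card_uniqP ut _ _]; rewrite -(size_tuple t) -ut max_card.
case: (ex_maxnP exQ Qle) => n Qn nmax.
have {Qn} [t [ut st St sz]] : exists t : seq W,
    [/\ uniq t, sorted F t, {subset t <= S} & size t = n].
  case/existsP: Qn => t /and3P[ut st /allP St].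
  by exists t; rewrite ut st size_tuple; split.
have max (q : seq W) : uniq q -> sorted F q -> {subset q <= S} -> size q <= n.
  move=> uq sq qS; apply: nmax; apply/existsP; exists (in_tuple q).
  by rewrite uq sq /=; apply/allP.
have n0 : 0 < n by apply: (max [:: x0]) => // z; rewrite inE => /eqP ->.
have tP i : i.+1 < n -> F (nth x0 t i) (nth x0 t i.+1).
  by rewrite -sz => h; apply/(sortedP x0 st).
have inj i j : i < n -> j < n -> (nth x0 t i == nth x0 t j) = (i == j).
  by move=> hi hj; rewrite nth_uniq ?sz.
have inter i z : 0 < i -> i.+1 < n -> F (nth x0 t i) z ->
    z = nth x0 t i.-1 \/ z = nth x0 t i.+1.
  case: i => // i _ hi Fz /=.
  have [->|z1] := eqVneq z (nth x0 t i); first by left.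
  have [->|z2] := eqVneq z (nth x0 t i.+2); first by right.
  exfalso; apply: (@no_three_nbrs (nth x0 t i.+1) z (nth x0 t i) (nth x0 t i.+2)) => //.
  - by rewrite adj_sym tP //; lia.
  - by rewrite tP.
  - by rewrite /= !inE negb_or z1 z2 inj; lia.
exists t; split=> //; first by rewrite -size_eq0 sz -lt0n.
move=> y0 x y xt Fxy.
have hdE : head y0 t = nth x0 t 0 by rewrite -nth0; apply: set_nth_default; rewrite sz.
have ltE : last y0 t = nth x0 t n.-1.
  by rewrite -nth_last sz; apply: set_nth_default; rewrite sz; lia.
have yS : y \in S by apply: Scl Fxy; apply: St.
have [i hi Ex] : exists2 i, i < n & x = nth x0 t i.
  by exists (index x t); rewrite ?nth_index // -sz index_mem.
have nbr k : k.+1 < n -> x = nth x0 t k -> y = nth x0 t k.+1 -> infix [:: x; y] t.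
  by move=> hk -> ->; apply: infix_nth; rewrite sz.
have nbr' k : k.+1 < n -> y = nth x0 t k -> x = nth x0 t k.+1 -> infix [:: y; x] t.
  by move=> hk -> ->; apply: infix_nth; rewrite sz.
have int_i : 0 < i -> i.+1 < n -> infix [:: x; y] t \/ infix [:: y; x] t.
  move=> i0 i1; rewrite Ex in Fxy; case: (inter _ _ i0 i1 Fxy) => Ey; [right|left].
    by apply: (nbr' i.-1); rewrite ?prednK //; lia.
  exact: (nbr i).
(* A neighbour of an end lying off the path could be put in front or at the back, giving a longer
   path. *)
have yt : y \in t.
  have [i0|i0] := posnP i; last have [i1|i1] := ltnP i.+1 n.
  - apply/negPn/negP => yt; suff : n < n by rewrite ltnn.
    rewrite -{1}sz; apply: (max (y :: t)); first by rewrite /= yt.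
    + rewrite /=; case E : t sz => [|a q]; first by move=> /= E0; rewrite -E0 in n0.
      by move=> _ /=; move: st; rewrite E /= => ->; move: Fxy; rewrite Ex i0 E /= adj_sym => ->.
    + by move=> z; rewrite inE => /predU1P[->//|/St].
  - by case: (int_i i0 i1) => /infix_mem[].
  - apply/negPn/negP => yt; suff : n < n by rewrite ltnn.
    rewrite -{1}sz -(size_rcons t y); apply: max.
    + by rewrite rcons_uniq yt.
    + have {}i1 : i = n.-1 by clear -i1 hi; lia.
      have : x = last y0 t by rewrite ltE Ex i1.
      case E : t sz => [|a q]; first by move=> /= E0; rewrite -E0 in n0.
      move=> _ /= Ex'; rewrite rcons_path -Ex' Fxy andbT.
      by move: st; rewrite E.
    + by move=> z; rewrite mem_rcons inE => /predU1P[->//|/St].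
have [j hj Ey] : exists2 j, j < n & y = nth x0 t j.
  by exists (index y t); rewrite ?nth_index // -sz index_mem.
have ij : i != j by rewrite -inj // -Ex -Ey; apply: contraTneq Fxy => ->; rewrite adj_irr.
have [/andP[i0 i1]|iN] := boolP ((0 < i) && (i.+1 < n)).
  by case: (int_i i0 i1); [constructor 1|constructor 2].
have [/andP[j0 j1]|jN] := boolP ((0 < j) && (j.+1 < n)).
  have Fyx : F (nth x0 t j) x by rewrite adj_sym -Ey.
  case: (inter _ _ j0 j1 Fyx) => E; [constructor 1|constructor 2].
    by apply: (nbr j.-1); rewrite ?prednK //; lia.
  exact: (nbr' j).
have {iN}iE : i = 0 \/ i = n.-1 by clear -iN hi; lia.
have {jN}jE : j = 0 \/ j = n.-1 by clear -jN hj; lia.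
(* Both [x] and [y] are ends by now. On two vertices the ends are consecutive; on three or more the
   edge closes a cycle. *)
have [n2|n3] := leqP n 2.
  have {}n2 : n = 2 by clear -n0 n2 ij iE jE; lia.
  rewrite n2 /= in iE jE.
  case: iE jE ij Ex Ey => -> [] ->; rewrite ?eqxx // => _ Ex Ey; [constructor 1|constructor 2].
    by apply: (nbr 0); rewrite ?n2.
  by apply: (nbr' 0); rewrite ?n2.
have ends : x = head y0 t /\ y = last y0 t \/ x = last y0 t /\ y = head y0 t.
  by rewrite hdE ltE; case: iE jE ij Ex Ey => -> [] ->; rewrite ?eqxx //; auto.
constructor 3; split=> //; rewrite /is_cycle sz n3 /=.
have {ends} : F (last y0 t) (head y0 t).
  by case: ends => -[<- <-] //; rewrite adj_sym.
case E : t st sz => [|a q] //= st' _ Fl.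
by rewrite rcons_path st' Fl.
Qed.

Lemma piece_closed p x y : piece p -> x \in p -> F x y -> y \in p.
Proof.
move=> Pp xp Fxy; case: (Pp x x y xp Fxy) => [/infix_mem[]//|/infix_mem[]//|].
by case=> _ []; case=> _ ->; case: p xp {Pp} => // a p _ /=; rewrite ?mem_last // inE eqxx.
Qed.

(** Pieces are peeled off one at a time: a piece is closed under adjacency, hence so is what remains
    of [S]. *)
Lemma piece_decomposition : exists P : seq (seq W),
  [/\ uniq (flatten P), flatten P =i W, [::] \notin P & forall p, p \in P -> piece p].
Proof.
suff H (S : {set W}) : (forall x y, x \in S -> F x y -> y \in S) ->
  exists P : seq (seq W),
  [/\ uniq (flatten P), flatten P =i S, [::] \notin P & forall p, p \in P -> piece p].
  have [//|P [uP PS PN pP]] := H [set: W]; exists P; split=> // x.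
  by rewrite PS !inE.
have [n] := ubnP #|S|; elim: n S => // n IH S nS Scl.
have [->|S0] := eqVneq S finset.set0; first by exists [::]; split=> // x; rewrite !inE.
have [p [p0 up pS Pp]] := piece_exists S0 Scl.
pose S' := S :\: [set x in p].
have [||P [uP PS PN pP]] := IH S'.
- suff : #|S'| < #|S| by move: nS; lia.
  apply: proper_card; apply/properP; split.
    by apply: subsetDl.
  case: p p0 pS {up Pp} @S' => // a p _ pS S'; exists a; first by rewrite pS // inE eqxx.
  by rewrite /S' !inE eqxx.
- move=> x y; rewrite !inE => /andP[xp xS] Fxy; rewrite (Scl _ _ xS Fxy) andbT.
  by apply: contra xp => yp; apply: (piece_closed Pp yp); rewrite adj_sym.
exists (p :: P); split=> [|x||q].
- rewrite /= cat_uniq up uP andbT /=; apply/hasPn => x; rewrite PS !inE => /andP[].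
  by [].
- by rewrite /= mem_cat PS !inE; case: (boolP (x \in p)) => //= /pS ->.
- by rewrite inE negb_or eq_sym p0.
- by rewrite inE => /predU1P[->//|/pP].
Qed.

End Decomposition.

(** * Short cycles and blocks of constant length *)

Section Blocks.
Variables (W : finType) (F : sgraph W).
Hypothesis Fdeg : max_degree F <= 2.

(** The index form of [cycle], with successors modulo the length, is the one that matches [ordS] in
    [cycle_graph]. *)
Lemma nth_cycle (T : eqType) (e : rel T) x0 (t : seq T) :
  reflect (forall i, i < size t -> e (nth x0 t i) (nth x0 t (i.+1 %% size t))) (cycle e t).
Proof.
case: t => [|a t]; first by constructor.
have E i : i <= size t -> nth x0 (a :: rcons t a) i = nth x0 (a :: t) i.
  by case: i => //= i it; rewrite nth_rcons it.
have E' i : i <= size t -> nth x0 (rcons t a) i = nth x0 (a :: t) (i.+1 %% (size t).+1).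
  rewrite nth_rcons leq_eqVlt => /predU1P[->|it]; first by rewrite ltnn eqxx modnn.
  by rewrite it modn_small.
rewrite /cycle; apply: (iffP (pathP x0)); rewrite size_rcons => h i it.
  by have := h i it; rewrite E // E'.
by rewrite E // E' //; apply: h.
Qed.

Lemma cycle_contains (p : seq W) : uniq p -> is_cycle F p ->
  contains F (cycle_graph (size p)).
Proof.
move=> up /andP[p3 cp]; case: p p3 cp up => // x0 q _.
set p := x0 :: q => /(nth_cycle _ x0) cp up.
exists [ffun i : 'I_(size p) => nth x0 p i]; apply/andP; split.
  by apply/injectiveP => i j; rewrite !ffunE => /eqP; rewrite nth_uniq // => /eqP/val_inj.
apply/forallP => i; apply/forallP => j; apply/implyP => /andP[_ /orP[]/eqP->]; rewrite !ffunE /=.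
  exact: cp.
by rewrite adj_sym; apply: cp.
Qed.

Definition ends (p : seq W) : seq W := if p is a :: q then [:: a; last a q] else [::].

Lemma size_flatten_ends P : size (flatten (map ends P)) <= 2 * size P.
Proof. by elim: P => //= p P IH; rewrite size_cat mulnS leq_add //; case: p. Qed.

Lemma size_filter_flatten k (P : seq (seq W)) :
  size [seq p <- P | k <= size p] * k <= size (flatten P).
Proof.
elim: P => //= p P IH; rewrite size_cat; case: (leqP k (size p)) => kp /=; first by rewrite ?mulSn leq_add.
by apply: leq_trans IH (leq_addl _ _).
Qed.

Lemma uniq_size_card (t : seq W) : uniq t -> size t <= #|W|.
Proof. by move=> /card_uniqP <-; apply: max_card. Qed.

(* The paths and the cycles of length at least l0 are strung together and cut
   into blocks of length s, which form Po; Ex collects the few vertices whose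
   neighbourhood is spoilt by this, and the vertices left over. *)
Lemma block_decomposition l s l0 : 2 <= s -> 0 < l0 -> girth_at_least F l ->
  exists (Pc Po : seq (seq W)) (Ex : seq W),
  [/\ uniq (flatten (Pc ++ Po)),
      forall p, p \in Pc -> 3 <= size p < l0 /\ l <= size p,
      forall p, p \in Po -> size p = s /\ {subset ends p <= Ex},
      forall x, x \notin Ex -> x \in flatten (Pc ++ Po) /\
        (forall p y, p \in Pc ++ Po -> x \in p -> F x y ->
            y = next p x \/ x = next p y) &
      size Ex <= 2 * (#|W| %/ l0) + 2 * (#|W| %/ s) + s].
Proof.
move=> s2 l0p gF; have [P [uP PW PN PP]] := piece_decomposition Fdeg.
(* Short cycles are kept whole; all other pieces are concatenated before cutting. *)
pose sh p := is_cycle F p && (size p < l0).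
pose Pc := seq.filter sh P; pose Lg := seq.filter (predC sh) P.
have perm : perm_eq (flatten (Pc ++ Lg)) (flatten P).
  by apply: perm_flatten; rewrite /Pc /Lg perm_filterC.
have uL : uniq (flatten Pc ++ flatten Lg) by rewrite -flatten_cat (perm_uniq perm).
have [|Po [r [EO aP rs]]] := @cut_blocks _ s (flatten Lg); first by lia.
pose lng := [seq p <- Lg | l0 <= size p].
(* A cycle left in [Lg] has length at least [l0] and loses its closing edge, whose ends are put into
   [Ex]. The other losses occur at block ends and in the remainder [r]. *)
pose Ex := flatten (map ends lng) ++ flatten (map ends Po) ++ r.
have uPo : uniq (flatten Po ++ r) by rewrite -EO; move: uL; rewrite cat_uniq => /and3P[].
have endsE Q p : p \in Q -> {subset ends p <= flatten (map ends Q)}.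
  by move=> pQ x xp; apply/flattenP; exists (ends p) => //; apply: map_f.
have up p : p \in P -> uniq p.
  by move=> pP; case/splitPr: pP uP => P1 P2; rewrite flatten_cat /= !cat_uniq => /and3P[_ _ /and3P[]].
have uF : uniq (flatten (Pc ++ Po)).
  by move: uL; rewrite EO catA cat_uniq flatten_cat => /and3P[].
exists Pc, Po, Ex; split=> //.
- move=> p; rewrite mem_filter => /andP[/andP[cp pl] pP].
  move: (cp) => /andP[p3 _]; rewrite p3 pl; split=> //.
  by apply: gF => //; apply: cycle_contains => //; apply: up.
- move=> p pPo; split; first by apply/eqP; apply: (allP aP).
  by move=> x xp; rewrite !mem_cat (endsE Po p) ?orbT.
- move=> x; rewrite !mem_cat !negb_or => /and3P[x1 x2 x3].
  have xF : x \in flatten (Pc ++ Po).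
    have : x \in flatten (Pc ++ Lg) by rewrite (perm_mem perm) PW.
    by rewrite !flatten_cat EO !mem_cat (negPf x3) orbF.
  split=> // p y pP xp Fxy.
  have inf q : q \in P -> x \in q -> ~~ (is_cycle F q && ((x == head x q) || (x == last x q))) ->
      infix [:: x; y] q \/ infix [:: y; x] q.
    move=> qP xq; case: (PP q qP x x y xq Fxy) => [h|h|[cq h]]; [by left|by right|].
    by rewrite cq; case: h => -[<- _]; rewrite eqxx ?orbT.
  have end_mem q : x \in q -> (x == head x q) || (x == last x q) -> x \in ends q.
    by case: q => // a q _ /= /orP[]/eqP E; rewrite !inE -E eqxx ?orbT.
  move: pP; rewrite mem_cat => /orP[pPc|pPo].
    move: (pPc); rewrite mem_filter => /andP[/andP[cp _] pP].
    case: (PP p pP x x y xp Fxy) => [h|h|[_ h]].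
    - by left; rewrite (next_infix (up p pP) h).
    - by right; rewrite (next_infix (up p pP) h).
    - have nl : next p (last x p) = head x p.
        by apply: next_last; [apply: up|case: (p) xp].
      by case: h => -[Ex' Ey]; [right; rewrite Ey nl|left; rewrite Ey -nl -Ex'].
  have hx : forall q, x \in q -> x \notin ends q -> x != head x q /\ x != last x q.
    move=> q xq xe; split; apply: contra xe => e; apply: end_mem => //; rewrite e ?orbT //.
  have [xh xl] : x != head x p /\ x != last x p.
    by apply: hx => //; apply: contra x2; apply: endsE.
  (* With [r] appended as one more block, the blocks concatenate to all of [flatten Lg], as
     [infix_block] requires. *)
  have E1 : flatten (Po ++ [:: r]) = flatten Lg by rewrite flatten_cat /= cats0 EO.
  apply: (infix_block (P := Po ++ [:: r]) _ _ _ xh xl) => //; rewrite ?E1 ?EO //.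
    by rewrite mem_cat pPo.
  rewrite -EO.
  have xL : x \in flatten Lg.
    by rewrite EO mem_cat; apply/orP; left; apply/flattenP; exists p.
  have [q qL xq] := flattenP xL.
  have [] : infix [:: x; y] q \/ infix [:: y; x] q.
    apply: inf => //; first by move: qL; rewrite mem_filter => /andP[].
    apply/negP => /andP[cq hq]; move/negP: x1; apply.
    have qlng : q \in lng.
      rewrite mem_filter qL andbT leqNgt; apply/negP => ql.
      by move: qL; rewrite mem_filter /= /sh cq ql.
    by apply: (endsE lng q qlng); apply: end_mem.
  - by move=> h; left; apply: infix_flatten h.
  - by move=> h; right; apply: infix_flatten h.
- rewrite !size_cat.
  have h1 : size (flatten (map ends lng)) <= 2 * (#|W| %/ l0).
    apply: leq_trans (size_flatten_ends _) _; rewrite leq_mul2l /= leq_divRL //.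
    apply: leq_trans (size_filter_flatten l0 Lg) (uniq_size_card _).
    by move: uL; rewrite cat_uniq => /and3P[].
  have h2 : size (flatten (map ends Po)) <= 2 * (#|W| %/ s).
    apply: leq_trans (size_flatten_ends _) _; rewrite leq_mul2l /= leq_divRL; last by lia.
    have := size_filter_flatten s Po; rewrite (eq_in_filter (a2 := predT)); last first.
      by move=> p pP; rewrite (eqP (allP aP p pP)) leqnn.
    rewrite filter_predT => h; apply: leq_trans h (uniq_size_card _).
    by move: uPo; rewrite cat_uniq => /and3P[].
  by lia.
Qed.
End Blocks.

(** * Repairing an almost embedding *)

Lemma leq_cardsD (T : finType) (A B : {set T}) a b :
  a <= #|A| -> #|B| <= b -> a - b <= #|A :\: B|.
Proof.
move=> aA Bb; rewrite cardsD; apply: leq_sub => //.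
by apply: leq_trans Bb; apply: subset_leq_card; apply: subsetIr.
Qed.

Section Repair.
Variables (W V : finType) (F : sgraph W) (Ga G : sgraph V) (q : nat).
Hypothesis Fdeg : max_degree F <= 2.
Hypothesis G_edge : forall X Y : {set V}, [disjoint X & Y] -> q <= #|X| -> q <= #|Y| ->
  exists x y, [/\ x \in X, y \in Y & G x y].
Let H := gunion Ga G.

(* Such a w may take v as its new image, which frees f w, a Ga-neighbour of y. *)
Definition swappable (f : {ffun W -> V}) (v y : V) : {set W} :=
  [set w | Ga y (f w) && [forall u, F w u ==> Ga v (f u)]].

(** Ordered pairs: every broken edge is counted twice. *)
Definition bad_pairs (f : {ffun W -> V}) : {set W * W} :=
  [set e | F e.1 e.2 && ~~ H (f e.1) (f e.2)].

Definition nbhd (X : {set W}) : {set W} := X :|: \bigcup_(x in X) [set y | F x y].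

Lemma card_nbhd X : #|nbhd X| <= 3 * #|X|.
Proof.
suff h : #|\bigcup_(x in X) [set y | F x y]| <= 2 * #|X|.
  by apply: leq_trans (leq_card_setU _ _) _; lia.
apply: leq_trans (_ : \sum_(x in X) #|[set y | F x y]| <= _); last first.
  rewrite mulnC -sum_nat_const; apply: leq_sum => x _.
  by apply: leq_trans Fdeg; exact: (leq_bigmax x).
elim/big_rec2: _ => [|x m B _ h]; first by rewrite cards0.
by apply: leq_trans (leq_card_setU _ _) _; rewrite leq_add2l.
Qed.

(** At most two neighbours leave at most one besides [w]. If there is none, the claim is vacuous and
    [u] serves as a default. *)
Lemma other_nbr u w : exists u', forall x, F u x -> x != w -> F u w -> x = u'.
Proof.
have [/existsP[u' /andP[Fu uw]]|/existsPn h] := boolP [exists x, F u x && (x != w)].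
  exists u' => x Fx xw Fuw; apply/eqP/negPn/negP => xu'.
  by apply: (@no_three_nbrs _ F Fdeg u x w u') => //=; rewrite !inE negb_or xw xu' eq_sym uw.
by exists u => x Fx xw; have := h x; rewrite Fx xw.
Qed.

Lemma subset_card (T : finType) (X : {set T}) m : m <= #|X| -> exists2 Y : {set T}, Y \subset X & #|Y| = m.
Proof.
move=> mX; exists [set x in take m (enum X)].
  by apply/subsetP => x; rewrite inE => /mem_take; rewrite mem_enum.
rewrite cardsE; have /card_uniqP -> : uniq (take m (enum X)) by rewrite take_uniq ?enum_uniq.
by rewrite size_take_min -cardE; apply/minn_idPl.
Qed.

(* A bad edge uw is repaired by exchanging f u and f w with f w1 and f w2, where
   f w1 and f w2 are adjacent in G and Ga takes care of all other edges at u, w,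
   w1 and w2. *)
Lemma repair_step (f : {ffun W -> V}) r : injective f -> bad_pairs f != finset.set0 ->
  4 * q + 60 <= r -> (forall v y, r <= #|swappable f v y|) ->
  exists g : {ffun W -> V}, [/\ injective g, #|bad_pairs g| < #|bad_pairs f| &
    forall v y, #|swappable f v y| <= #|swappable g v y| + 12].
Proof.
move=> finj /set0Pn[[u w]]; rewrite inE /= => /andP[Fuw Huw] rq rZ.
have Fwu : F w u by rewrite adj_sym.
have uw : u != w by apply: contraTneq Fuw => ->; rewrite adj_irr.
have [u' hu'] := other_nbr u w; have [w' hw'] := other_nbr w u.
have c2 : #|[set u; w]| <= 2 by rewrite cards2; case: (_ != _).
(* Avoiding [E1] keeps [w1] and [w2] distinct from and not adjacent to [u] and [w]. *)
pose E1 := nbhd [set u; w].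
have cE1 : #|E1| <= 6 by apply: leq_trans (card_nbhd _) _; lia.
have [Z1 Z1s cZ1] : exists2 Z1 : {set W}, Z1 \subset swappable f (f u) (f u') :\: E1 & #|Z1| = q.
  by apply: subset_card; apply: leq_trans (leq_cardsD (rZ _ _) cE1); lia.
have cN : #|nbhd Z1| <= 3 * q by rewrite -cZ1 card_nbhd.
(* Avoiding the closed neighbourhood of [Z1] as well makes [w1] and [w2] distinct and not adjacent.
   The excluded sets have size at most 6 + 3q, which leaves [q] candidates. *)
have [Z2 Z2s cZ2] : exists2 Z2 : {set W},
    Z2 \subset swappable f (f w) (f w') :\: (E1 :|: nbhd Z1) & #|Z2| = q.
  have cE : #|E1 :|: nbhd Z1| <= 6 + 3 * q.
    by apply: leq_trans (leq_card_setU _ _) _; apply: leq_add.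
  by apply: subset_card; apply: leq_trans (leq_cardsD (rZ _ _) cE); lia.
have [|||a [b [/imsetP[w1 w1Z ->] /imsetP[w2 w2Z ->] G12]]] := @G_edge (f @: Z1) (f @: Z2).
- rewrite disjoints_subset; apply/subsetP => _ /imsetP[z zZ ->]; rewrite inE.
  apply/imsetP => -[z' z'Z /finj zz']; subst z'.
  by have := subsetP Z2s z z'Z; rewrite !inE zZ /= orbT.
- by rewrite card_imset // cZ1.
- by rewrite card_imset // cZ2.
have := subsetP Z1s _ w1Z; rewrite inE => /andP[w1E]; rewrite inE => /andP[yw1 /forallP fw1].
have := subsetP Z2s _ w2Z; rewrite inE finset.in_setU negb_or => /andP[/andP[w2E w2N]]; rewrite inE => /andP[yw2 /forallP fw2].
have inE1 x : x \in E1 = [|| x == u, x == w, F u x | F w x].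
  rewrite !inE -orbA; congr [|| _, _ | _]; apply/bigcupP/orP.
    by case=> z; rewrite !inE => /orP[]/eqP ->; [left|right].
  by case=> h; [exists u|exists w]; rewrite ?inE ?eqxx ?orbT.
move: w1E w2E; rewrite !inE1 !negb_or => /and4P[w1u w1w Fuw1 Fww1] /and4P[w2u w2w Fuw2 Fww2].
have w21 : w2 != w1 by apply: contraNneq w2N => ->; rewrite inE w1Z.
have F12 : ~~ F w1 w2.
  apply: contra w2N => h; rewrite inE; apply/orP; right.
  by apply/bigcupP; exists w1; rewrite // inE.
(* The involution exchanging [u] with [w1] and [w] with [w2]. *)
pose sg x := if x == u then w1 else if x == w1 then u else if x == w then w2
             else if x == w2 then w else x.
have sgK : involutive sg.
  move=> x; rewrite /sg; case: (eqVneq x u) => [->|xu].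
    by rewrite (negPf w1u) eqxx.
  case: (eqVneq x w1) => [->|xw1]; first by rewrite eqxx.
  case: (eqVneq x w) => [->|xw].
    by rewrite (negPf w2u) (negPf w21) (negPf w2w) eqxx.
  case: (eqVneq x w2) => [->|xw2].
    by rewrite eq_sym (negPf uw) eq_sym (negPf w1w) eqxx.
  by rewrite (negPf xu) (negPf xw1) (negPf xw) (negPf xw2).
have sgu : sg u = w1 by rewrite /sg eqxx.
have sgw : sg w = w2 by rewrite /sg eq_sym (negPf uw) eq_sym (negPf w1w) eqxx.
have sgw1 : sg w1 = u by rewrite -sgu sgK.
have sgw2 : sg w2 = w by rewrite -sgw sgK.
have sgx x : x \notin [:: u; w; w1; w2] -> sg x = x.
  rewrite !inE !negb_or => /and4P[xu xw xw1 xw2].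
  by rewrite /sg (negPf xu) (negPf xw) (negPf xw1) (negPf xw2).
pose g := [ffun x => f (sg x)].
have ginj : injective g.
  by move=> x y; rewrite !ffunE => /finj; apply: (inv_inj sgK).
(* No edge at a moved vertex is broken after the exchange, so no bad pair arises and (u, w)
   disappears. The edge uw is carried by [G], every other edge at these vertices by [Ga]. *)
have good x y : x \in [:: u; w; w1; w2] -> F x y -> H (g x) (g y).
  have HC a1 b1 : H a1 b1 = H b1 a1 by rewrite adj_sym.
  rewrite !inE => /or4P[]/eqP->; rewrite !ffunE.
  - move=> Fy; rewrite sgu; have [->|yw] := eqVneq y w; first by rewrite sgw /H /= G12 orbT.
    rewrite sgx; first by rewrite (hu' y) // HC /H /= yw1.
    rewrite !inE !negb_or yw /=; apply/and3P; split; apply: contraTneq Fy => ->.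
    + by rewrite adj_irr.
    + by rewrite (negPf Fuw1).
    + by rewrite (negPf Fuw2).
  - move=> Fy; rewrite sgw; have [->|yu] := eqVneq y u; first by rewrite sgu HC /H /= G12 orbT.
    rewrite sgx; first by rewrite (hw' y) // HC /H /= yw2.
    rewrite !inE !negb_or yu /=; apply/and3P; split; apply: contraTneq Fy => ->.
    + by rewrite adj_irr.
    + by rewrite (negPf Fww1).
    + by rewrite (negPf Fww2).
  - move=> Fy; rewrite sgw1 sgx; first by have := fw1 y; rewrite Fy /H /= => ->.
    rewrite !inE !negb_or; apply/and4P; split; apply: contraTneq Fy => ->.
    + by rewrite adj_sym (negPf Fuw1).
    + by rewrite adj_sym (negPf Fww1).
    + by rewrite adj_irr.
    + by rewrite (negPf F12).
  - move=> Fy; rewrite sgw2 sgx; first by have := fw2 y; rewrite Fy /H /= => ->.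
    rewrite !inE !negb_or; apply/and4P; split; apply: contraTneq Fy => ->.
    + by rewrite adj_sym (negPf Fuw2).
    + by rewrite adj_sym (negPf Fww2).
    + by rewrite adj_sym (negPf F12).
    + by rewrite adj_irr.
exists g; split=> //.
- apply: proper_card; apply/properP; split; last first.
    exists (u, w); first by rewrite inE /= Fuw.
    rewrite inE; apply/negP => /andP[_ /negP]; apply; apply: good => //.
    by rewrite inE eqxx.
  apply/subsetP => -[x y]; rewrite inE => /andP[Fxy hb]; rewrite inE; apply/andP; split=> //; move: hb.
  have [xm|xm] := boolP (x \in [:: u; w; w1; w2]); first by move/negP; case; apply: good.
  have [ym|ym] := boolP (y \in [:: u; w; w1; w2]).
    by move/negP; case; rewrite adj_sym; apply: good; rewrite // adj_sym.
  by rewrite !ffunE !sgx.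
(* A vertex can stop being swappable only if it or one of its neighbours has moved; this concerns at
   most 3 * 4 = 12 vertices. *)
- move=> v y; pose M := [set x in [:: u; w; w1; w2]].
  have cM : #|M| <= 4 by rewrite cardsE; apply: leq_trans (card_size _) _.
  have cNM : #|nbhd M| <= 12.
    by apply: leq_trans (card_nbhd _) _; rewrite -[12]/(3 * 4) leq_mul2l.
  rewrite -(cardsID (nbhd M) (swappable f v y)) addnC; apply: leq_add; last first.
    by apply: leq_trans cNM; apply: subset_leq_card; apply: subsetIr.
  apply: subset_leq_card; apply/subsetP => x; rewrite finset.in_setD => /andP[xM].
  have xm : x \notin [:: u; w; w1; w2] by apply: contra xM => h; rewrite !inE; move: h; rewrite !inE => ->.
  rewrite !inE => /andP[h /forallP h']; rewrite ffunE sgx // h /=.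
  apply/forallP => z; apply/implyP => Fxz; rewrite ffunE sgx; first by have := h' z; rewrite Fxz.
  apply: contra xM => zm; rewrite inE; apply/orP; right.
  by apply/bigcupP; exists z; rewrite inE // adj_sym.
Qed.

(** Induction on the number of bad pairs. A repair removes at least one of them and costs at most 12
    swappable vertices per pair (v, y), whence the coefficient 12. *)
Lemma repair (f : {ffun W -> V}) : injective f ->
  (forall v y, 12 * #|bad_pairs f| + 4 * q + 60 <= #|swappable f v y|) ->
  contains H F.
Proof.
have [n] := ubnP #|bad_pairs f|; elim: n f => // n IH f bn finj hf.
have [b0|b0] := eqVneq (bad_pairs f) finset.set0.
  exists f; apply/andP; split; first exact/injectiveP.
  apply/forallP => x; apply/forallP => y; apply/implyP => Fxy.
  by apply/negPn/negP => h; move/setP: b0 => /(_ (x, y)); rewrite !inE /= Fxy h.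
have [|g [ginj gb gs]] := @repair_step f _ finj b0 _ hf; first by lia.
apply: (IH g) => //; first by lia.
by move=> v y; have := hf v y; have := gs v y; move: gb; lia.
Qed.

End Repair.

(** * From embedded pieces to an embedding *)

Section Triples.

(** The windows of three consecutive entries, with the middle at [.1.2]. No window wraps around,
    even when the list is a cycle. *)
Fixpoint triples (T : Type) (s : seq T) : seq (T * T * T) :=
  if s is a :: s' then
    if s' is x :: b :: _ then (a, x, b) :: triples s' else [::]
  else [::].

Lemma triples_map (S T : Type) (f : S -> T) s :
  triples (map f s) = [seq (f e.1.1, f e.1.2, f e.2) | e <- triples s].
Proof. by elim: s => // a [|x [|b s]] IH //=; rewrite -IH. Qed.

Lemma mem_triples (T : eqType) (s : seq T) a x b : (a, x, b) \in triples s ->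
  exists s1 s2, s = s1 ++ [:: a, x, b & s2].
Proof.
elim: s => // a' [|x' [|b' s]] IH //; rewrite [triples _]/= inE => /predU1P[[-> -> ->]|/IH[s1 [s2 ->]]].
  by exists [::], s.
by exists (a' :: s1), s2.
Qed.

(** Ensures that in a duplicate-free list different windows have different middles, so that hits
    count different vertices. *)
Lemma subseq_middles (T : eqType) (s : seq T) : subseq [seq e.1.2 | e <- triples s] (behead s).
Proof.
elim: s => // a [|x [|b s]] IH //; rewrite [triples _]/= map_cons /= eqxx.
exact: IH.
Qed.

End Triples.

Section Assembly.
Variables (W V : finType) (F : sgraph W) (Ga G : sgraph V) (q : nat).
Hypothesis Fdeg : max_degree F <= 2.
Hypothesis G_edge : forall X Y : {set V}, [disjoint X & Y] -> q <= #|X| -> q <= #|Y| ->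
  exists x y, [/\ x \in X, y \in Y & G x y].
Let H := gunion Ga G.

(** If the window is the image of a vertex of [F] between its two neighbours, that vertex is
    swappable for (v, y). *)
Definition absorbs (v y : V) (e : V * V * V) : bool :=
  [&& Ga y e.1.2, Ga v e.1.1 & Ga v e.2].

Definition hits (v y : V) (t : seq V) : nat := count (absorbs v y) (triples t).

Lemma hits_cons v y a t : hits v y t <= hits v y (a :: t).
Proof. by rewrite /hits; case: t => [|x [|b t]] //=; rewrite leq_addl. Qed.

Lemma hits_cat v y t1 t2 : hits v y t1 + hits v y t2 <= hits v y (t1 ++ t2).
Proof.
elim: t1 => [|a t1 IH] //; case: t1 IH => [|x t1] IH; first by apply: hits_cons.
case: t1 IH => [|b t1] IH.
  by rewrite /hits /= add0n; apply: leq_trans IH (hits_cons _ _ _ _).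
have E t : hits v y [:: a, x, b & t] = absorbs v y (a, x, b) + hits v y [:: x, b & t] by [].
by rewrite E -addnA [X in _ <= X]E leq_add2l.
Qed.

(** An entry of [PT] is a list of vertices of [F] together with the host list that is to be its
    image, entry by entry. [Ex] holds the vertices whose edges may break; a host list need not close
    up when the ends of its piece lie in [Ex]. *)
Variables (PT : seq (seq W * seq V)) (Ex : seq W) (h : nat).
Hypothesis cardWV : #|W| = #|V|.
Hypothesis uniqW : uniq (flatten (unzip1 PT)).
Hypothesis uniqV : uniq (flatten (unzip2 PT)).
Hypothesis nbrP : forall x, x \notin Ex -> x \in flatten (unzip1 PT) /\
  (forall p y, p \in unzip1 PT -> x \in p -> F x y -> y = next p x \/ x = next p y).
Hypothesis PT_ok : forall pt, pt \in PT -> size pt.1 = size pt.2 /\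
  (cycle H pt.2 \/ sorted H pt.2 /\ {subset ends pt.1 <= Ex}).
Hypothesis hitsP : forall v y, h <= \sum_(pt <- PT) hits v y pt.2.
Hypothesis h_large : 25 * size Ex + 4 * q + 60 <= h.

(** Both vertex sets are listed with the pieces first and matched by position. Corresponding pieces
    have equal length, so the matching respects the division into pieces. *)
Lemma pieces_bijection : exists f : {ffun W -> V}, injective f /\
  forall pt, pt \in PT -> pt.2 = map f pt.1.
Proof.
have sz : size (flatten (unzip1 PT)) = size (flatten (unzip2 PT)).
  rewrite !size_flatten /shape -!map_comp; congr sumn; apply/eq_in_map => pt /PT_ok[] //.
pose LW := flatten (unzip1 PT) ++ [seq x <- enum W | x \notin flatten (unzip1 PT)].
pose LV := flatten (unzip2 PT) ++ [seq x <- enum V | x \notin flatten (unzip2 PT)].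
have comp (T : finType) (s : seq T) : uniq s ->
    let L := s ++ [seq x <- enum T | x \notin s] in [/\ uniq L, L =i T & size L = #|T|].
  move=> us L; have uL : uniq L.
    rewrite cat_uniq us filter_uniq ?enum_uniq // andbT.
    by apply/hasPn => x; rewrite mem_filter => /andP[].
  have TL : L =i T by move=> x; rewrite mem_cat mem_filter mem_enum andbT; case: (x \in s).
  by split=> //; rewrite -(card_uniqP uL); apply: eq_card.
have [uLW WLW sLW] := comp _ _ uniqW; have [uLV VLV sLV] := comp _ _ uniqV.
rewrite -/LW in uLW WLW sLW; rewrite -/LV in uLV VLV sLV.
(* With [V] empty there is no default for [nth], but then [W] is empty too. *)
have [v0 _|V0] := pickP V; last first.
  have W0 (w : W) : False.
    have : 0 < #|W| by apply/card_gt0P; exists w.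
    by rewrite cardWV eq_card0.
  exists [ffun w => match W0 w with end]; split=> [w|]; first by case: (W0 w).
  case=> p t /PT_ok[/= E _]; case: p E => [|w]; last by case: (W0 w).
  by case: t.
pose f := [ffun w => nth v0 LV (index w LW)].
have fLW : map f LW = LV.
  apply: (@eq_from_nth _ v0); rewrite size_map sLW ?sLV // => i iW.
  have [w _] : exists w : W, true by have /card_gt0P[w] : 0 < #|W| by lia; exists w.
  by rewrite (nth_map w) ?sLW // ffunE index_uniq // sLW.
have finj : injective f.
  move=> x y; rewrite !ffunE => /eqP; rewrite nth_uniq ?sLV -?cardWV -?sLW ?index_mem ?WLW //.
  have yL : y \in LW by rewrite WLW.
  by move/eqP => e; have := nth_index x yL; rewrite -e nth_index // WLW.
exists f; split=> //.
have E : map (map f) (unzip1 PT) = unzip2 PT.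
  apply: eq_from_flatten_shape; last first.
    by rewrite /shape -!map_comp; apply/eq_in_map => pt /PT_ok[/= E _]; rewrite size_map.
  rewrite -map_flatten; move: fLW; rewrite map_cat => /eqP.
  by rewrite eqseq_cat ?size_map // => /andP[/eqP].
move=> pt ptP; move: E; rewrite /unzip1 /unzip2 -map_comp => /eq_in_map/(_ pt ptP) /= ->.
by [].
Qed.

(** A bad pair has its first vertex in [Ex], and a vertex is first in at most two pairs. *)
Lemma few_bad_pairs (f : {ffun W -> V}) : (forall pt, pt \in PT -> pt.2 = map f pt.1) ->
  #|bad_pairs F Ga G f| <= 2 * size Ex.
Proof.
move=> fP; have good x y : x \notin Ex -> F x y -> H (f x) (f y).
  move=> xE Fxy; have [/flattenP[p pP xp] /(_ p y pP xp Fxy) hn] := nbrP xE.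
  have /mapP[pt ptP Ep] := pP.
  pose e a b := H (f a) (f b) || (a \in Ex) && (b \in Ex).
  have ce : cycle e p.
    have [_] := PT_ok ptP; rewrite (fP _ ptP) -Ep; case.
      case: (p) => // a t; rewrite /= -map_rcons path_map; apply: sub_path => z z' zz.
      by apply/orP; left.
    case: (p) => // a t /= [pt' ex]; rewrite rcons_path; apply/andP; split.
      by move: pt'; rewrite path_map; apply: sub_path => z z' zz; apply/orP; left.
    by rewrite /e !ex ?orbT // !inE eqxx ?orbT.
  case: hn => E.
    by have := next_cycle ce xp; rewrite -E /e (negPf xE) orbF.
  have yp : y \in p.
    apply: contraLR Fxy => yp; rewrite E next_nth (negPf yp) adj_irr.
    by [].
  by have := next_cycle ce yp; rewrite -E /e (negPf xE) andbF orbF adj_sym.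
have sub : bad_pairs F Ga G f \subset \bigcup_(x in [set x in Ex]) [set (x, y) | y in [set y | F x y]].
  apply/subsetP => -[x y]; rewrite inE => /andP[/= Fxy Hxy].
  apply/bigcupP; exists x; last by apply/imsetP; exists y; rewrite // inE.
  by rewrite inE; apply: contraR Hxy => xE; apply: good.
apply: leq_trans (subset_leq_card sub) _.
apply: leq_trans (_ : \sum_(x in [set x in Ex]) 2 <= _); last first.
  by rewrite sum_nat_const mulnC leq_mul2l /= cardsE card_size.
elim/big_rec2: _ => [|x m B _ IH]; first by rewrite cards0.
apply: leq_trans (leq_card_setU _ _) _; apply: leq_add IH.
apply: leq_trans (leq_imset_card _ _) _; apply: leq_trans Fdeg; exact: (leq_bigmax x).
Qed.

(** The middle of a window absorbing (v, y) has its neighbours in [F] among the two outer entries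
    unless it lies in [Ex]; hence it is swappable. Middles of different windows differ. *)
Lemma many_swappable (f : {ffun W -> V}) v y :
  (forall pt, pt \in PT -> pt.2 = map f pt.1) ->
  h <= #|swappable F Ga f v y| + size Ex.
Proof.
move=> fP; apply: leq_trans (hitsP v y) _.
pose ab (e : W * W * W) := absorbs v y (f e.1.1, f e.1.2, f e.2).
pose M := flatten [seq [seq e.1.2 | e <- triples p & ab e] | p <- unzip1 PT].
have -> : \sum_(pt <- PT) hits v y pt.2 = size M.
  rewrite size_flatten /shape /unzip1 -!map_comp sumnE big_map; apply: eq_big_seq => pt ptP.
  by rewrite /= size_map size_filter /hits (fP _ ptP) triples_map count_map.
have uM : uniq M.
  apply: subseq_uniq uniqW; rewrite /M; elim: (unzip1 PT) => //= p P IH.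
  apply: cat_subseq IH; apply: subseq_trans (map_subseq _ (filter_subseq _ _)) _.
  by apply: subseq_trans (subseq_middles _) _; case: p => // a p; apply: subseq_cons.
have sM : {subset M <= enum (swappable F Ga f v y) ++ Ex}.
  move=> x /flattenP[_ /mapP[p pP ->] /mapP[[[a x'] b]]]; rewrite mem_filter => /andP[+ /mem_triples[s1 [s2 Ep]] /= Ex'].
  subst x'; rewrite mem_cat => /and3P[/= gx ga gb]; have [xE|xE] := boolP (x \in Ex); first by rewrite orbT.
  rewrite orbF mem_enum inE gx; apply/forallP => u; apply/implyP => Fxu.
  have up : uniq p.
    by case/splitPr: pP uniqW => P1 P2; rewrite flatten_cat /= !cat_uniq => /and3P[_ _ /and3P[]].
  have ax : next p a = x by apply: next_infix => //; apply/infix_cat_cons; exists s1, (b :: s2).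
  have xb : next p x = b.
    by apply: next_infix => //; apply/infix_cat_cons; exists (s1 ++ [:: a]), s2; rewrite -catA.
  have xp : x \in p by rewrite Ep mem_cat !inE eqxx !orbT.
  have [_ /(_ p u pP xp Fxu)[->|E]] := nbrP xE; first by rewrite xb.
  by rewrite -(prev_next up u) -E -ax prev_next.
by have := uniq_leq_size uM sM; rewrite size_cat -cardE.
Qed.

Lemma assembly : contains H F.
Proof.
have [f [finj fP]] := pieces_bijection.
(* The 25 in [h_large] is 12 * 2 for the bad pairs plus 1 for the hits lost to [Ex]. *)
apply: (@repair _ _ F Ga G q Fdeg G_edge f finj) => v y.
by have := few_bad_pairs fP; have := @many_swappable f v y fP; lia.
Qed.

End Assembly.

(** * Selecting absorbers *)

(** Greedy choice: the set with index j avoids at most jq vertices taken before. In the induction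
    the sets not yet chosen are empty. *)
Lemma disjoint_choice (V : finType) k q (S : 'I_k -> {set V}) :
  (forall i, k * q <= #|S i|) ->
  exists Vs : 'I_k -> {set V}, [/\ pairwise_disjoint Vs, forall i, Vs i \subset S i &
    forall i, #|Vs i| = q].
Proof.
move=> hS.
suff : forall j, j <= k -> exists Vs : 'I_k -> {set V}, [/\ pairwise_disjoint Vs,
    forall i, Vs i \subset S i & forall i : 'I_k, #|Vs i| = if i < j then q else 0].
  case/(_ k (leqnn k)) => Vs [h1 h2 h3]; exists Vs; split=> // i; rewrite h3 ltn_ord //.
elim=> [|j IH] jk.
  exists (fun _ => finset.set0); split=> [i i' _|i|i]; rewrite ?cards0 ?sub0set //.
  by rewrite disjoints_subset sub0set.
have [Vs [dV sV cV]] := IH (ltnW jk).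
pose U := \bigcup_i Vs i; pose oj := Ordinal jk.
have cU : #|U| <= j * q.
  apply: (@leq_trans (\sum_i #|Vs i|)).
    rewrite /U; elim/big_rec2: _ => [|x m B _ h]; first by rewrite cards0.
    by apply: leq_trans (leq_card_setU _ _) _; rewrite leq_add2l.
  rewrite (eq_bigr (fun i : 'I_k => if i < j then q else 0)) // -big_mkcond /=.
  rewrite (big_ord_narrow (ltnW jk)).
  by rewrite sum_nat_const card_ord.
have [Y Ys cY] : exists2 Y : {set V}, Y \subset S oj :\: U & #|Y| = q.
  apply: subset_card; apply: leq_trans (leq_cardsD (hS oj) cU).
  by rewrite -mulnBl; apply: leq_pmull; rewrite subn_gt0.
have YU i : [disjoint Y & Vs i].
  rewrite disjoints_subset; apply/subsetP => x /(subsetP Ys); rewrite !inE => /andP[xU _].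
  by apply: contra xU => xi; apply/bigcupP; exists i.
exists (fun i => if i == oj then Y else Vs i); split=> [i i' ii'|i|i].
- case: eqP => [E|_]; case: eqP => [E'|_]; rewrite ?dV //.
  + by rewrite E E' eqxx in ii'.
  + by rewrite disjoint_sym.
- by case: eqP => // ->; apply: subset_trans Ys (subsetDl _ _).
- case: eqP => [->|ni]; first by rewrite /= ltnSn.
  have ij : (i : nat) <> j by move=> E; apply: ni; apply: val_inj.
  by rewrite cV; have -> : (i < j.+1) = (i < j) by lia.
Qed.

Section MultiplicativeWeights.
Local Open Scope ring_scope.
(** [J] are the demands and [Ob] the available objects; [supp o] are the vertices used by [o], and
    [good j o] says that [o] serves [j]. By [dense], whichever at most [M] vertices are forbidden, a
    fraction 1/d of all objects is free and serves a given demand. *)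
Variables (J O : finType) (V : eqType) (Ob : {set O}) (supp : O -> seq V).
Variables (good : J -> O -> bool) (d c M : nat) (j0 : J).
Hypothesis d_gt0 : (0 < d)%N.
Hypothesis suppP : forall o, o \in Ob -> uniq (supp o) /\ (size (supp o) <= c)%N.

Definition free_good (U : seq V) (j : J) : {set O} :=
  [set o in Ob | ~~ has (mem U) (supp o) && good j o].

Hypothesis dense : forall U j, (size U <= M)%N ->
  (0 < #|free_good U j|)%N /\ (#|Ob| <= d * #|free_good U j|)%N.

(** The factor by which one choice shrinks the total weight. *)
Let x : rat := 1 - (2 * d)%:R^-1.

(* Double counting: by density an average free object hits a fraction 1/d of
   the total weight. *)
Lemma heavy_object (w : J -> rat) (U : seq V) : (forall j, 0 <= w j) -> (size U <= M)%N ->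
  exists o, [/\ o \in Ob, ~~ has (mem U) (supp o) &
    \sum_j w j <= d%:R * \sum_(j | good j o) w j].
Proof.
move=> w0 UM; pose Ob' := [set o in Ob | ~~ has (mem U) (supp o)].
pose Wt := \sum_j w j.
have [/existsP[ob /andP[oO oW]]|/existsPn no] :=
  boolP [exists o, (o \in Ob') && (Wt <= d%:R * \sum_(j | good j o) w j)].
  by exists ob; move: oO; rewrite inE => /andP[].
exfalso.
have pos o : o \in Ob' -> 0 < Wt - d%:R * \sum_(j | good j o) w j.
  by move=> oO; have := no o; rewrite oO /= -ltNge subr_gt0.
have [b0 b0O] : exists o, o \in Ob'.
  have [/card_gt0P[ob obG] _] := dense j0 UM.
  by exists ob; move: obG; rewrite !inE andbA => /andP[].
have Wt0 : 0 <= Wt by apply: sumr_ge0.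
suff : \sum_(o in Ob') (Wt - d%:R * \sum_(j | good j o) w j) <= 0.
  apply/negP; rewrite -ltNge (bigD1 b0) //= ltr_wpDr ?pos //.
  by apply: sumr_ge0 => o /andP[oO _]; apply/ltW/pos.
rewrite sumrB subr_le0 sumr_const -mulr_sumr.
rewrite (exchange_big_dep xpredT) //= mulr_sumr.
apply: (@le_trans _ _ (Wt * #|Ob|%:R)).
  rewrite mulr_natr; apply: ler_wpMn2l => //.
  by apply/subset_leq_card/subsetP => o; rewrite inE => /andP[].
rewrite mulr_suml; apply: ler_sum => j _.
rewrite sumr_const -[X in _ <= _ * X]mulr_natr mulrCA; apply: ler_wpM2l => //.
rewrite -natrM ler_nat; have [_ h] := dense j UM; apply: leq_trans h _.
rewrite leq_mul2l; apply/orP; right; apply/subset_leq_card/subsetP => o.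
rewrite inE => /and3P[h1 h2 h3].
by rewrite unfold_in /= !inE h1 h2.
Qed.

(** The new object serves at least a fraction 1/d of the total weight and halves the weight it
    serves, so the total drops by a fraction of at least 1/(2d). *)
Lemma weights_decrease m : (c * m <= M)%N -> exists os : seq O,
  [/\ size os = m, {subset os <= Ob}, uniq (flatten (map supp os)) &
    \sum_j (2^-1 : rat) ^+ (count (good j) os) <= #|J|%:R * x ^+ m].
Proof.
elim: m => [|m IH] cm.
  exists [::]; split=> //; rewrite mulr1 (eq_bigr (fun=> 1)) ?sumr_const //.
have [|os [so osO uo pot]] := IH; first by apply: leq_trans cm; rewrite leq_mul2l leqnSn orbT.
have sU : (size (flatten (map supp os)) <= M)%N.
  apply: leq_trans cm; rewrite mulnC -so; apply: (@leq_trans (size os * c)); last first.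
    by rewrite leq_mul2r leqnSn orbT.
  elim: (os) osO => //= o s IHs sO; rewrite size_cat mulSn leq_add //.
    by have [] := suppP (sO o (mem_head _ _)).
  by apply: IHs => z zs; apply: sO; rewrite inE zs orbT.
pose w j := (2^-1 : rat) ^+ (count (good j) os).
have w0 j : 0 <= w j by rewrite exprn_ge0 // invr_ge0.
have [ob [oO oU ow]] := heavy_object w0 sU.
exists (ob :: os); split=> /=.
- by rewrite so.
- by move=> z; rewrite inE => /predU1P[->//|/osO].
- by rewrite cat_uniq uo andbT has_sym oU andbT; have [] := suppP oO.
rewrite exprS mulrCA.
have x0 : 0 <= x.
  by rewrite /x subr_ge0 invf_le1 ?ltr0n ?ler1n ?muln_gt0.
apply: le_trans (ler_wpM2l x0 pot).
rewrite (eq_bigr (fun j => w j - 2^-1 * (if good j ob then w j else 0))); last first.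
  move=> j _; rewrite /w; case: (good j ob); rewrite /= ?add1n ?exprS; last by rewrite mulr0 subr0.
  by field.
rewrite sumrB -mulr_sumr -big_mkcond /= /x mulrBl mul1r lerD2l lerN2.
rewrite natrM invfM -mulrA ler_wpM2l ?invr_ge0 //.
by rewrite ler_pdivrMl ?ltr0n.
Qed.

(** With y = 1/(2d), Bernoulli gives (1 + y)^(2d) >= 2, while (1 - y)(1 + y) <= 1. *)
Lemma decay : x ^+ (2 * d) <= 2^-1.
Proof.
have y0 : 0 < (2 * d)%:R^-1 :> rat by rewrite invr_gt0 ltr0n muln_gt0.
have y1 : (2 * d)%:R^-1 <= 1 :> rat by rewrite invf_le1 ?ltr0n ?ler1n ?muln_gt0.
have bern n (y : rat) : 0 <= y -> 1 + n%:R * y <= (1 + y) ^+ n.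
  move=> yp; elim: n => [|n IH]; first by rewrite mul0r addr0.
  rewrite exprS; apply: le_trans (ler_wpM2l _ IH); last by rewrite addr_ge0.
  rewrite -natr1; have : 0 <= n%:R * y * y by rewrite !mulr_ge0.
  by rewrite /=; lra.
have := bern (2 * d)%N _ (ltW y0); rewrite mulfV; last first.
  by rewrite pnatr_eq0 -lt0n muln_gt0.
set y := (_^-1) in y0 y1 *; move=> h.
have x0 : 0 <= x by rewrite /x subr_ge0.
have h1 : x ^+ (2 * d) * (1 + y) ^+ (2 * d) <= 1.
  rewrite -exprMn exprn_ile1 //; first by rewrite mulr_ge0 // addr_ge0 // ltW.
  by rewrite /x -/y; nra.
have := ler_wpM2l (exprn_ge0 (2 * d) x0) h.
lra.
Qed.

(** Since 4dh = 2d * 2h, the total weight falls to at most |J| * 2^(-2h) <= 2^(-h). Each single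
    weight 2^(-count) is then at most 2^(-h). *)
Lemma many_hits m h : (c * m <= M)%N -> (4 * d * h <= m)%N -> (#|J| <= 2 ^ h)%N ->
  exists os : seq O, [/\ size os = m, {subset os <= Ob}, uniq (flatten (map supp os)) &
    forall j, (h <= count (good j) os)%N].
Proof.
move=> cm hm Jh; have [os [so osO uo pot]] := weights_decrease cm.
exists os; split=> // j.
have i0 : 0 <= 2^-1 :> rat by rewrite invr_ge0.
have x0 : 0 <= x by rewrite /x subr_ge0 invf_le1 ?ltr0n ?ler1n ?muln_gt0.
have x1 : x <= 1 by rewrite /x gerBl invr_ge0.
have : (2^-1 : rat) ^+ count (good j) os <= 2^-1 ^+ h.
  apply: (@le_trans _ _ (\sum_j (2^-1 : rat) ^+ (count (good j) os))).
    rewrite (bigD1 j) //= lerDl; apply: sumr_ge0 => i _; exact: exprn_ge0.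
  apply: le_trans pot _.
  apply: (@le_trans _ _ ((2 ^ h)%:R * (2^-1 ^+ (h + h)))); last first.
    by rewrite exprD mulrA natrX -exprMn mulfV // expr1n mul1r.
  apply: ler_pM => //; first exact: exprn_ge0; first by rewrite ler_nat.
  apply: (@le_trans _ _ (x ^+ (4 * d * h))); first exact: ler_wiXn2l.
  have -> : (4 * d * h = (2 * d) * (h + h))%N by lia.
  by rewrite exprM; apply: lerXn2r decay; rewrite nnegrE ?exprn_ge0.
by rewrite ler_iXn2l // ?invr_gt0 // invf_lt1.
Qed.

End MultiplicativeWeights.

(** * Building cycles and paths in the union *)

Section Building.
Variables (V : finType) (Ga G : sgraph V) (q K : nat).
Hypothesis q_gt0 : 0 < q.
Hypothesis G_edge : forall X Y : {set V}, [disjoint X & Y] -> q <= #|X| -> q <= #|Y| ->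
  exists x y, [/\ x \in X, y \in Y & G x y].
Hypothesis Ga_deg : forall v, K <= #|[set y | Ga v y]|.
Let H := gunion Ga G.
Implicit Types (U c g : seq V) (gs ts : seq (seq V)).

Lemma card_avoid (X : {set V}) (U : seq V) a : a + size U <= #|X| ->
  a <= #|X :\: [set x in U]|.
Proof.
move=> h; apply: leq_trans (leq_cardsD (leqnn _) (_ : #|_| <= size U)).
  by rewrite leq_subRL ?(addnC (size U)) //; apply: leq_trans h; apply: leq_addl.
by rewrite cardsE card_size.
Qed.

(** The first [m] vertices are found greedily along [Ga]. The last two are the ends of a [G]-edge
    between a neighbourhood of the current vertex and one of [z], both taken in [Ga], trimmed to
    disjoint sets of size [q]. *)
Lemma connect_by m y z (U : seq V) : size U + m + 2 + 2 * q <= K ->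
  exists c : seq V, [/\ size c = m + 2, uniq c, ~~ has (mem U) c & path H y (rcons c z)].
Proof.
elim: m y U => [|m IH] y U hK.
  have [X Xs cX] : exists2 X : {set V}, X \subset [set x | Ga y x] :\: [set x in U] & #|X| = q.
    by apply: subset_card; apply: card_avoid; apply: leq_trans (Ga_deg y); lia.
  have [Y Ys cY] : exists2 Y : {set V},
      Y \subset ([set x | Ga z x] :\: [set x in U]) :\: X & #|Y| = q.
    apply: subset_card; apply: leq_trans (leq_cardsD (leqnn _) (eq_leq cX)).
    rewrite leq_subRL; last first.
      by apply: card_avoid; apply: leq_trans (Ga_deg z); lia.
    by apply: card_avoid; apply: leq_trans (Ga_deg z); lia.
  have dXY : [disjoint X & Y].
    rewrite disjoint_sym disjoints_subset; apply/subsetP => x /(subsetP Ys).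
    by rewrite inE finset.in_setC => /andP[].
  have [||a [b [aX bY Gab]]] := G_edge dXY; rewrite ?cX ?cY //.
  have := subsetP Xs a aX; have := subsetP Ys b bY; rewrite !inE => /and3P[bX bU zb] /andP[aU ya].
  exists [:: a; b]; split=> //=.
  - by rewrite inE andbT; apply: contraNneq bX => <-.
  - by rewrite !negb_or aU bU.
  - by rewrite ya Gab (adj_sym Ga b z) zb !orbT.
have /card_gt0P[r] : 0 < #|[set x | Ga y x] :\: [set x in U]|.
  by apply: card_avoid; apply: leq_trans (Ga_deg y); lia.
rewrite !inE => /andP[rU yr].
have [|c [sc uc cU pc]] := IH r (r :: U); first by rewrite /=; lia.
exists (r :: c); split=> /=.
- by rewrite sc.
- rewrite uc andbT; apply: contra cU => rc; apply/hasP; exists r => //.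
  exact: mem_head.
- rewrite negb_or rU /=; apply: contra cU => /hasP[x xc xU]; apply/hasP; exists x => //.
  exact: mem_behead.
- by rewrite pc yr.
Qed.

Definition cherry_list (g : seq V) : bool := (size g == 3) && sorted H g.

Lemma hasN_mem (U c : seq V) x : ~~ has (mem U) c -> x \in c -> x \notin U.
Proof. by move=> /hasPn h /h. Qed.

(** Each cherry is followed by two connecting vertices, hence 5 vertices per cherry. The last
    connection, towards [z], takes up the surplus [rr]. *)
Lemma chain_cherries rr z a g gs (U : seq V) : all cherry_list ((a :: g) :: gs) ->
  uniq (flatten ((a :: g) :: gs)) -> {subset flatten ((a :: g) :: gs) <= U} ->
  size U + 5 * (size gs).+1 + rr + 2 * q <= K ->
  exists t : seq V, [/\ size (a :: t) = 5 * (size gs).+1 + rr, uniq (a :: t),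
    forall x, x \in a :: t -> x \in flatten ((a :: g) :: gs) \/ x \notin U,
    path H a (rcons t z) &
    forall v y, \sum_(c <- (a :: g) :: gs) hits Ga v y c <= hits Ga v y (a :: t)].
Proof.
elim: gs a g U => [|g2 gs IH] a g U /=.
  rewrite !andbT cats0 => /andP[]; case: g => [|x [|b [|]]] //= _ /and3P[ax xb _] ug sU hK.
  have [|c [sc uc cU pc]] := @connect_by rr b z U; first by clear -hK; lia.
  have cN y : y \in [:: a; x; b] -> y \notin c.
    by move=> yg; apply: contraTN (sU y yg) => yc; apply: hasN_mem cU yc.
  exists [:: x, b & c]; split=> [||y||v y].
  - by rewrite /= sc; clear; lia.
  - change (uniq ([:: a; x; b] ++ c)); rewrite cat_uniq uc andbT; apply/andP; split=> //.
    by apply/hasPn => y yc; apply/negP => /cN; rewrite yc.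
  - rewrite (mem_cat _ [:: a; x; b] c) => /orP[|yc]; first by left.
    by right; apply: hasN_mem cU yc.
  - by rewrite /= ax xb pc.
  - rewrite big_seq1; apply: leq_trans (hits_cat Ga v y [:: a; x; b] c).
    exact: leq_addr.
move=> /andP[/andP[]]; case: g => [|x [|b [|]]] //= _ /and3P[ax xb _] /andP[cg2 cgs].
case: g2 cg2 => [|a2 g2] // cg2 ug sU hK.
have uF : uniq (flatten ((a2 :: g2) :: gs)) by move: ug => /and4P[].
have [|c [sc uc cU pc]] := @connect_by 0 b a2 U; first by clear -hK; lia.
have inF y : y \in flatten ((a2 :: g2) :: gs) -> y \in U.
  move=> yF; apply: sU; change (y \in [:: a; x; b] ++ flatten ((a2 :: g2) :: gs)).
  by rewrite mem_cat yF orbT.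
have [||||t [st ut tU pt ht]] := IH a2 g2 (c ++ U).
- by rewrite /= cg2.
- by [].
- by move=> y yF; rewrite mem_cat inF ?orbT.
- by rewrite size_cat sc; clear -hK; lia.
have cN y : y \in [:: a; x; b] -> y \notin c.
  move=> yg; have yU : y \in U by apply: sU; move: yg; rewrite !inE => /or3P[]/eqP->; rewrite eqxx ?orbT.
  by apply: contraTN yU => yc; apply: hasN_mem cU yc.
have aN y : y \in [:: a; x; b] -> y \notin flatten ((a2 :: g2) :: gs).
  move: ug => /and4P[]; rewrite !inE !negb_or => /and3P[_ _ h1] /andP[_ h2] h3 _.
  by case/or3P=> /eqP->.
have tN y : y \in [:: a; x; b] -> y \notin a2 :: t.
  move=> yg; apply/negP => /tU[h|]; first by have := aN y yg; rewrite h.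
  rewrite mem_cat negb_or => /andP[_]; apply/negP/negPn; apply: sU.
  by move: yg; rewrite !inE => /or3P[]/eqP->; rewrite eqxx ?orbT.
exists [:: x, b & c ++ a2 :: t]; split=> [||y||v y].
- by move: st; rewrite /= size_cat sc /=; clear; lia.
- have u3 : uniq [:: a; x; b].
    by move: ug => /and4P[]; rewrite /= !inE !negb_or => /and3P[-> -> _] /andP[-> _].
  change (uniq ([:: a; x; b] ++ (c ++ a2 :: t))); rewrite cat_uniq u3 cat_uniq uc ut.
  apply/and3P; split=> //; last apply/and3P; last split=> //; apply/hasPn => y.
    rewrite mem_cat => /orP[yc|yt]; apply/negP => yg.
      by have := cN y yg; rewrite yc.
    by have := tN y yg; rewrite yt.
  move=> /tU[/inF yU|]; first by apply: contraTN yU => yc; apply: hasN_mem cU yc.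
  by rewrite mem_cat negb_or => /andP[].
- have -> : a :: [:: x, b & c ++ a2 :: t] = [:: a; x; b] ++ (c ++ a2 :: t) by [].
  rewrite mem_cat mem_cat => /or3P[yg|yc|/tU[yt|yt]].
  + by left; move: yg; rewrite !inE => /or3P[]/eqP->; rewrite eqxx ?orbT.
  + by right; apply: hasN_mem cU yc.
  + left; change (y \in [:: a; x; b] ++ flatten ((a2 :: g2) :: gs)).
    by rewrite mem_cat yt orbT.
  + by right; move: yt; rewrite mem_cat negb_or => /andP[].
- move: pc; rewrite rcons_path => /andP[pc1 pc2].
  have p2 : path H b (c ++ a2 :: rcons t z).
    by rewrite cat_path pc1; move: pc2 pt; rewrite /H /= => -> ->.
  by rewrite /= ax xb rcons_cat.
- rewrite big_cons; apply: leq_trans (hits_cat Ga v y [:: a; x; b] (c ++ a2 :: t)).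
  rewrite leq_add2l; apply: leq_trans (hits_cat Ga v y c (a2 :: t)).
  by apply: leq_trans (ht v y) _; rewrite leq_addl.
Qed.

(** A cycle of length k consumes k %/ 5 cherries; the remainder of k modulo 5 lengthens its last
    connection. *)
Lemma cycles_with_cherries ks gs U : all (leq 5) ks -> size gs = \sum_(k <- ks) k %/ 5 ->
  all cherry_list gs -> uniq (flatten gs) -> {subset flatten gs <= U} ->
  size U + sumn ks + 2 * q <= K ->
  exists ts : seq (seq V), [/\ map size ts = ks, all (cycle H) ts, uniq (flatten ts),
    forall x, x \in flatten ts -> x \in flatten gs \/ x \notin U &
    forall v y, \sum_(c <- gs) hits Ga v y c <= \sum_(t <- ts) hits Ga v y t].
Proof.
elim: ks gs U => [|k ks IH] gs U.
  by move=> _; rewrite big_nil => /size0nil -> _ _ _ _; exists [::].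
rewrite big_cons [all _ _]/= [sumn _]/= => /andP[k5 ks5] sg cg ug sU hK.
have k0 : 0 < k %/ 5 by rewrite divn_gt0.
pose g1 := take (k %/ 5) gs; pose g2 := drop (k %/ 5) gs.
have Eg : gs = g1 ++ g2 by rewrite cat_take_drop.
have sg1 : size g1 = k %/ 5 by rewrite size_take_min sg; apply/minn_idPl; apply: leq_addr.
have sg2 : size g2 = \sum_(k <- ks) k %/ 5 by rewrite size_drop sg addKn.
move: cg ug sU; rewrite Eg all_cat flatten_cat cat_uniq => /andP[cg1 cg2] /and3P[ug1 dg ug2] sU.
case E1 : g1 sg1 cg1 => [|[|a g] g1'] sg1 cg1 //; first by rewrite -sg1 in k0.
have kE := divn_eq k 5.
(* Taking the starting vertex [a] as the target closes the chain to a cycle. *)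
have [|||t1 [st ut tU pt ht]] := @chain_cherries (k %% 5) a a g g1' U cg1.
- by rewrite -E1.
- by move=> x xg; apply: sU; rewrite mem_cat E1 xg.
- by move: sg1 => /= ->; lia.
have [||ts [sts cts uts tsU hts]] := IH g2 ((a :: t1) ++ U) ks5 sg2 cg2 ug2.
- by move=> x xg; rewrite mem_cat sU ?orbT // mem_cat xg orbT.
- by rewrite size_cat st; move: sg1 => /= ->; clear -hK kE; lia.
exists ((a :: t1) :: ts); split=> [||||v y].
- by rewrite map_cons sts st; move: sg1 => /= ->; rewrite {3}kE mulnC.
- by rewrite /= pt cts.
- change (uniq ((a :: t1) ++ flatten ts)); rewrite cat_uniq ut uts andbT.
  apply/hasPn => x /tsU[xg|]; last first.
    by rewrite mem_cat negb_or => /andP[].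
  apply/negP => /tU[xg1|]; last by apply/negP/negPn; apply: sU; rewrite mem_cat xg orbT.
  by move/hasPn: dg => /(_ x xg) /=; rewrite E1 xg1.
- move=> x; have -> : flatten ((a :: t1) :: ts) = (a :: t1) ++ flatten ts by [].
  rewrite mem_cat => /orP[/tU[xg|xU]|/tsU[xg|xU]].
  + by left; rewrite mem_cat ?E1 xg.
  + by right.
  + by left; rewrite mem_cat xg orbT.
  + by right; move: xU; rewrite mem_cat negb_or => /andP[].
- by rewrite big_cat [X in _ <= X]big_cons; apply: leq_add.
Qed.

(** [T] collects at least [q] starting points of paths with [s] edges. For one more edge, 2q
    vertices are set aside first; fewer than [q] of them lack a [G]-neighbour in [T], and all others
    extend a path. *)
Lemma long_path_from s (S : {set V}) : 2 * q * s.+1 <= #|S| ->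
  exists T : {set V}, [/\ q <= #|T|, T \subset S & forall x, x \in T -> exists p : seq V,
    [/\ size p = s, path G x p, uniq (x :: p) & {subset x :: p <= S}]].
Proof.
elim: s S => [|s IH] S hS.
  exists S; split=> //; first by apply: leq_trans hS; lia.
  by move=> x xS; exists [::]; split=> // y; rewrite inE => /eqP->.
have [S1 S1s cS1] : exists2 S1 : {set V}, S1 \subset S & #|S1| = 2 * q.
  by apply: subset_card; apply: leq_trans hS; rewrite leq_pmulr.
have [|T [qT TS Tp]] := IH (S :\: S1).
  by apply: leq_trans (leq_cardsD hS (eq_leq cS1)); rewrite [_ * s.+2]mulnS addKn.
pose T1 := [set z in S1 | [exists x in T, G z x]].
exists T1; split.
- rewrite leqNgt; apply/negP => qT1.
  have [||x [y [xX yT Gxy]]] := @G_edge (S1 :\: T1) T _ _ qT.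
  + rewrite disjoint_sym disjoints_subset; apply/subsetP => x /(subsetP TS).
    by rewrite !inE => /andP[/negPf -> _]; rewrite andbF.
  + by apply: leq_trans (leq_cardsD (eq_leq (esym cS1)) (ltnW qT1)); lia.
  + move: xX; rewrite !inE => /andP[/negP + xS1]; apply; rewrite xS1 /=.
    by apply/existsP; exists y; rewrite yT.
- by apply: subset_trans S1s; apply/subsetP => z; rewrite inE => /andP[].
- move=> z; rewrite inE => /andP[zS1 /existsP[x /andP[xT Gzx]]].
  have [p [sp pp up pS]] := Tp x xT; exists (x :: p); split=> //=.
  + by rewrite sp.
  + by rewrite Gzx.
  + change ((z \notin x :: p) && uniq (x :: p)); rewrite up andbT; apply/negP => /pS.
    by rewrite inE zS1.
  + move=> y; rewrite inE => /predU1P[->|/pS]; first exact: (subsetP S1s).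
    by rewrite inE => /andP[].
Qed.

(** One piece after another is placed while at least [D] host vertices are free; [R2] are the pieces
    left over. *)
Lemma greedy_pieces (W : finType) (ok : seq W -> seq V -> Prop) D (Rs : seq (seq W)) (U : seq V) :
  (forall p U', p \in Rs -> uniq U' -> size U' + D <= #|V| ->
     exists t : seq V, [/\ size t = size p, uniq t, ~~ has (mem U') t & ok p t]) ->
  uniq U ->
  exists (PT : seq (seq W * seq V)) R2, [/\ Rs = unzip1 PT ++ R2,
    forall pt, pt \in PT -> size pt.1 = size pt.2 /\ ok pt.1 pt.2,
    uniq (U ++ flatten (unzip2 PT)) &
    R2 = [::] \/ #|V| < size U + size (flatten (unzip2 PT)) + D].
Proof.
elim: Rs U => [|p Rs IH] U hR uU; first by exists [::], [::]; split=> //=; rewrite ?cats0 //; left.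
have [UD|UD] := leqP (size U + D) #|V|; last first.
  by exists [::], (p :: Rs); split=> //=; rewrite ?cats0 //; right; rewrite addn0.
have [t [st ut tU okt]] := hR p U (mem_head _ _) uU UD.
have [||PT [R2 [ER PTok uPT sPT]]] := IH (U ++ t).
- by move=> p' U' p'R; apply: hR; rewrite inE p'R orbT.
- by rewrite cat_uniq uU ut andbT.
exists ((p, t) :: PT), R2; split=> /=.
- by rewrite ER.
- by move=> pt; rewrite inE => /predU1P[->|/PTok].
- by rewrite catA.
- by move: sPT; rewrite !size_cat !addnA.
Qed.

End Building.

(** * Consequences of the pseudorandomness axioms *)

Lemma ncopies_in_gt0 (W V : finType) (T : sgraph W) (G : sgraph V) (Vs : W -> {set V}) :
  0 < ncopies_in T G Vs -> exists f : {ffun W -> V}, embedding T G f /\ forall x, f x \in Vs x.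
Proof.
case/card_gt0P => x /imsetP[f]; rewrite inE => /andP[ef /forallP fV] _.
by exists f.
Qed.

(** Embeddings with the same copy have the same image, of at most k vertices, so there are at most
    k^k of them. *)
Lemma card_embeddings k (V : finType) (T : sgraph 'I_k) (G : sgraph V) :
  #|[set f : {ffun 'I_k -> V} | embedding T G f]| <= k ^ k * ncopies T G.
Proof.
set Ob := [set f : {ffun 'I_k -> V} | embedding T G f].
rewrite /ncopies -/Ob.
rewrite -sum1_card (partition_big_imset (copy T)) /=.
apply: (@leq_trans (\sum_(o in [set copy T f | f in Ob]) k ^ k)); last first.
  by rewrite sum_nat_const mulnC.
apply: leq_sum => _ /imsetP[f fO ->]; rewrite sum1_card.
apply: (@leq_trans #|ffun_on (mem (f @: [set: 'I_k]))|).
  apply/subset_leq_card/subsetP => g; rewrite unfold_in => /andP[_ /eqP [E _]].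
  apply/ffun_onP => x; have : g x \in [set g x | x : 'I_k] by apply: imset_f.
  by rewrite E; case/imsetP => z _ ->; apply: imset_f; rewrite inE.
rewrite card_ffun_on card_ord; case: k f {Ob T fO} => [|k] f; first by rewrite !expn0.
by rewrite leq_exp2r // (leq_trans (leq_imset_card _ _)) // cardsT card_ord.
Qed.

Section Density.
Local Open Scope ring_scope.

(** Lower and upper bound carry the same power of [p], which cancels. This makes the density of good
    copies a constant independent of [p] and [n]. *)
Lemma density_ratio (R : realType) (p : R) (n B k e : nat) (c : R) (X Y : nat) (a : 'I_k -> nat) :
  (0 < n)%N -> 0 < p -> 4^-1 <= c -> (forall i, (n <= B * a i)%N) ->
  c * p ^+ e * \prod_i (a i)%:R <= X%:R -> Y%:R <= p ^+ e * n%:R ^+ k ->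
  (0 < X)%N /\ (Y <= 4 * B ^ k * X)%N.
Proof.
move=> n0 p0 c4 na hX hY.
have a0 i : (0 < a i)%N by have := na i; case: (a i) => //; rewrite muln0 leqNgt n0.
have pr0 : 0 < \prod_i (a i)%:R :> R by apply: prodr_gt0 => i _; rewrite ltr0n.
have c0 : 0 < c by apply: lt_le_trans c4; rewrite invr_gt0.
have pe0 : 0 < p ^+ e by apply: exprn_gt0.
have X0 : 0 < X%:R :> R by apply: lt_le_trans hX; rewrite !mulr_gt0.
split; first by rewrite -(ltr0n R).
rewrite -(ler_nat R); apply: le_trans hY _.
have h : n%:R ^+ k <= B%:R ^+ k * \prod_i (a i)%:R :> R.
  have -> : n%:R ^+ k = \prod_(i < k) n%:R :> R by rewrite prodr_const card_ord.
  have -> : B%:R ^+ k = \prod_(i < k) B%:R :> R by rewrite prodr_const card_ord.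
  rewrite -big_split /=; apply: ler_prod => i _; rewrite ler0n -natrM ler_nat; exact: na.
rewrite !natrM natrX; apply: le_trans (ler_wpM2l (ltW pe0) h) _.
have h2 := ler_wpM2l (ltW c0) h.
set P := \prod_i _ in pr0 hX h *; set Bk := B%:R ^+ k.
have Bk0 : 0 <= Bk by apply: exprn_ge0; apply: ler0n.
have h3 : 4 * (c * p ^+ e * P) <= 4 * X%:R by rewrite ler_pM2l.
have h4 : p ^+ e * P <= 4 * (c * p ^+ e * P).
  have -> : 4 * (c * p ^+ e * P) = (4 * c) * (p ^+ e * P) by rewrite !mulrA.
  have q0 : 0 <= p ^+ e * P by apply: mulr_ge0; apply: ltW.
  have c1 : 1 <= 4 * c by move: c4; lra.
  by rewrite ler_peMl.
have -> : 4 * Bk * X%:R = Bk * (4 * X%:R) by rewrite mulrA [Bk * 4]mulrC.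
by rewrite mulrCA; apply: (ler_wpM2l Bk0); apply: le_trans h4 h3.
Qed.

End Density.

(** The order [s] is chosen so that the images form a path or cycle list, with the intended window
    in front. *)
Definition trace k (V : Type) (s : seq 'I_k) (f : {ffun 'I_k -> V}) : seq V :=
  [seq f i | i <- s].

Section Pseudorandomness.
Variables (R : realType) (n : nat) (p : R) (l0 l : nat) (V : finType) (G : sgraph V).
Hypothesis n_gt0 : 0 < n.
Hypothesis l0_gt0 : 0 < l0.
Hypothesis Gnpl : npl_graph n p l0 l G.

Let p_gt0 : (0 < p)%R.
Proof. by case: Gnpl => /andP[]. Qed.

Lemma size_quotient b a : n <= b * a -> 0 < b -> (n%:R / b%:R <= a%:R :> R)%R.
Proof. by move=> h b0; rewrite ler_pdivrMr ?ltr0n // mulrC -natrM ler_nat. Qed.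

Lemma npl_edge q (X Y : {set V}) : n <= l0 * q -> [disjoint X & Y] ->
  q <= #|X| -> q <= #|Y| -> exists x y, [/\ x \in X, y \in Y & G x y].
Proof.
move=> nq dXY qX qY; case: Gnpl => _ _ A1 _ _.
pose Vs (i : 'I_2) := if i == ord0 then X else Y.
have sz i : n <= l0 * #|Vs i|.
  by apply: leq_trans nq _; rewrite leq_mul2l /Vs; case: ifP; rewrite ?qX ?qY orbT.
have dV : pairwise_disjoint Vs.
  move=> i j; rewrite /Vs -!(inj_eq val_inj) /=.
  by case: i => [[|[|//]] hi]; case: j => [[|[|//]] hj] //= _; rewrite disjoint_sym.
have := A1 Vs dV (fun i => size_quotient (sz i) l0_gt0).
have q0 i : 0 < #|Vs i|.
  by have := sz i; case: #|Vs i| => //; rewrite muln0 leqNgt n_gt0.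
move=> hA; have /ncopies_in_gt0[f [ef fV]] : 0 < ncopies_in edge_graph G Vs.
  rewrite -(ltr0n R); apply: lt_le_trans hA; rewrite mulr_gt0 ?divr_gt0 //.
  by apply: prodr_gt0 => i _; rewrite ltr0n.
exists (f ord0), (f (lift ord0 ord0)); split.
- by have := fV ord0; rewrite /Vs eqxx.
- by have := fV (lift ord0 ord0).
- by case/andP: ef => _ /forallP/(_ ord0)/forallP/(_ (lift ord0 ord0))/implyP; apply.
Qed.

Lemma embedded_cycle k (f : {ffun 'I_k -> V}) : 1 < k -> embedding (cycle_graph k) G f ->
  cycle G (map f (enum 'I_k)) /\ uniq (map f (enum 'I_k)).
Proof.
case: k f => // k f k1 /andP[/injectiveP finj /forallP fe]; split; last first.
  by rewrite map_inj_uniq ?enum_uniq.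
have Enth i (ik : i < k.+1) : nth (f ord0) (map f (enum 'I_k.+1)) i = f (Ordinal ik).
  rewrite (nth_map ord0) ?size_enum_ord //; congr (f _); apply: val_inj.
  by rewrite /= nth_enum_ord.
apply/(nth_cycle G (f ord0)) => i; rewrite size_map size_enum_ord => ik.
have ik' : i.+1 %% k.+1 < k.+1 by rewrite ltn_mod.
rewrite (Enth _ ik) (Enth _ ik'); have := forallP (fe (Ordinal ik)) (Ordinal ik').
move/implyP; apply; apply/andP; split.
  apply/eqP => -[E]; move: ik; rewrite ltnS leq_eqVlt => /predU1P[Ei|ik].
    by move: E; rewrite Ei modnn => E; rewrite E in k1.
  by move: E; rewrite modn_small // => /n_Sn.
by apply/orP; left; apply/eqP/val_inj.
Qed.

Lemma npl_cycle k q (S : {set V}) : 3 <= k -> l <= k < l0 -> n <= l0 ^ 2 * q -> k * q <= #|S| ->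
  exists t : seq V, [/\ size t = k, uniq t, cycle G t & {subset t <= S}].
Proof.
move=> k3 kl nq qS; case: Gnpl => _ _ _ _ [A3 _].
have [Vs [dV sV cV]] := disjoint_choice (fun _ : 'I_k => qS).
have := A3 k kl Vs dV; rewrite -natrX => hA.
have /ncopies_in_gt0[f [ef fV]] : 0 < ncopies_in (cycle_graph k) G Vs.
  rewrite -(ltr0n R); apply: lt_le_trans (hA _).
    rewrite !mulr_gt0 ?divr_gt0 ?exprn_gt0 //; apply: prodr_gt0 => i _; rewrite ltr0n cV.
    by move: nq; case: q {qS cV} => //; rewrite muln0 leqNgt n_gt0.
  by move=> i; apply: size_quotient; rewrite ?cV // expn_gt0 l0_gt0.
have [|cf uf] := embedded_cycle _ ef; first by apply: leq_trans k3.
exists (map f (enum 'I_k)); split=> //; first by rewrite size_map size_enum_ord.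
by move=> _ /mapP[i _ ->]; apply: (subsetP (sV i)).
Qed.

(** * Disjoint cherries, triangles and 4-cycles serving all pairs *)

Section Absorbers.
Variables (Ga : sgraph V) (K B q m h : nat).
Hypothesis Ga_deg : forall v, K <= #|[set y | Ga v y]|.
Hypothesis nB : n <= B * q.
Hypothesis q_small : 4 * q + 4 * m <= K.
Hypothesis B_l0 : B <= l0.
Hypothesis m_large : 4 * (4 ^ 4 * (4 * B ^ 4)) * h <= m.
Hypothesis h_large : n ^ 2 <= 2 ^ h.
Let H := gunion Ga G.

Let B_gt0 : 0 < B.
Proof. by move: nB; case: B => //; rewrite mul0n leqNgt n_gt0. Qed.

(** Multiplicative weights with all pairs (v, y) as demands; there are n^2 of them, hence
    [n ^ 2 <= 2 ^ h]. An embedding serves (v, y) if it puts [c] into the neighbourhood of y and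
    everything else into that of v. *)
Lemma absorbers k (T : sgraph 'I_k) (c : 'I_k) (s : seq 'I_k) :
  k <= 4 -> uniq s ->
  (forall Vs : 'I_k -> {set V}, pairwise_disjoint Vs -> (forall i, n <= B * #|Vs i|) ->
     0 < ncopies_in T G Vs /\ ncopies T G <= 4 * B ^ k * ncopies_in T G Vs) ->
  exists fs : seq {ffun 'I_k -> V}, [/\ size fs = m, {in fs, forall f, embedding T G f},
    uniq (flatten (map (trace s) fs)) &
    forall v y, h <= count (fun f : {ffun 'I_k -> V} =>
      [forall i, f i \in if i == c then [set z | Ga y z] else [set z | Ga v z]]) fs].
Proof.
move=> k4 us ratio; pose Ob := [set f : {ffun 'I_k -> V} | embedding T G f].
have [_ cV _ _ _] := Gnpl.
have /card_gt0P[v0 _] : 0 < #|V| by rewrite cV.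
have k0 : 0 < k by case: (k) c => [[]|].
have ss : size s <= 4 by apply: leq_trans (uniq_size_card us) _; rewrite card_ord.
pose good (j : V * V) (f : {ffun 'I_k -> V}) :=
  [forall i, f i \in if i == c then [set z | Ga j.2 z] else [set z | Ga j.1 z]].
(* The factor 4^4 bounds the embeddings per copy, the factor 4B^4 is the ratio of all copies to
   those in prescribed classes. *)
pose d := (4 ^ 4 * (4 * B ^ 4)).
have d0 : 0 < d by rewrite /d !muln_gt0 B_gt0.
have dense U j : size U <= 4 * m ->
    0 < #|free_good Ob (trace s) good U j| /\
    #|Ob| <= d * #|free_good Ob (trace s) good U j|.
  move=> Um.
  pose S i := (if i == c then [set z | Ga j.2 z] else [set z | Ga j.1 z]) :\: [set x in U].
  have hS i : k * q <= #|S i|.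
    apply: card_avoid; apply: (@leq_trans K); last by case: ifP.
    by apply: leq_trans q_small; apply: leq_add => //; rewrite leq_mul2r k4 orbT.
  have [Vs [dV sV cVs]] := disjoint_choice hS.
  have [|r0 r1] := ratio Vs dV; first by move=> i; rewrite cVs.
  have le : ncopies_in T G Vs <= #|free_good Ob (trace s) good U j|.
    apply: leq_trans (leq_imset_card _ _) _; apply/subset_leq_card/subsetP => f.
    rewrite !inE => /andP[ef /forallP fV].
    have fS i : f i \in S i by apply: (subsetP (sV i)).
    apply/and3P; split=> //.
      apply/hasPn => _ /mapP[i _ ->]; have := fS i; rewrite inE => /andP[].
      by rewrite inE.
    by apply/forallP => i; have := fS i; rewrite finset.in_setD => /andP[].
  split; first exact: leq_trans le.
  apply: leq_trans (card_embeddings _ _) _.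
  apply: leq_trans (leq_mul (leqnn _) (leq_trans r1 (leq_mul (leqnn _) le))) _.
  rewrite mulnA leq_mul2r; apply/orP; right; rewrite /d leq_mul //; last first.
    by rewrite leq_mul2l leq_pexp2l.
  by apply: (@leq_trans (4 ^ k)); [rewrite leq_exp2r|rewrite leq_pexp2l].
have supp f : f \in Ob -> uniq (trace s f) /\ size (trace s f) <= 4.
  rewrite inE => /andP[/injectiveP finj _].
  by rewrite /trace map_inj_uniq // us size_map.
have [|||fs [sf fO uf hf]] := @many_hits _ _ _ Ob (trace s) good d 4 (4 * m)
    (v0, v0) d0 supp dense m h.
- by [].
- by [].
- by rewrite card_prod cV -[_ * _]/(n ^ 2).
exists fs; split=> // [f /fO|v y]; first by rewrite inE.
exact: (hf (v, y)).
Qed.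

Lemma sum_hits_count (S : eqType) (P : pred S) (g : S -> seq V) (fs : seq S) v y :
  (forall f, f \in fs -> P f -> 0 < hits Ga v y (g f)) ->
  count P fs <= \sum_(t <- map g fs) hits Ga v y t.
Proof.
move=> hP; rewrite big_map -sum1_count big_mkcond big_seq [X in _ <= X]big_seq.
by apply: leq_sum => f fF; case: ifP => // /hP; apply.
Qed.

Lemma hits_gt0 v y a x b t : Ga y x -> Ga v a -> Ga v b -> 0 < hits Ga v y [:: a, x, b & t].
Proof. by move=> yx va vb; rewrite /hits /= /absorbs /= yx va vb. Qed.

Lemma absorbing_cherries : exists gs : seq (seq V), [/\ size gs = m,
  all (cherry_list Ga G) gs, uniq (flatten gs) &
  forall v y, h <= \sum_(g <- gs) hits Ga v y g].
Proof.
(* The centre of [cherry] is index 0; listing it between the leaves makes the trace a path and its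
   only window the absorbing one. *)
pose a : 'I_3 := @Ordinal 3 1 isT; pose x : 'I_3 := @Ordinal 3 0 isT.
pose b : 'I_3 := @Ordinal 3 2 isT.
have [_ _ _ [A2 A2'] _] := Gnpl.
have [//|//||fs [sf ef uf hf]] := @absorbers 3 cherry x [:: a; x; b].
  move=> Vs dV nV.
  apply: (@density_ratio R p n B 3 2 4^-1 _ _ (fun i => #|Vs i|)) => //.
  rewrite [(4^-1 * _)%R]mulrC; apply: A2 => // i.
  by apply: size_quotient => //; apply: leq_trans (nV i) _; rewrite leq_mul2r B_l0 orbT.
exists (map (trace [:: a; x; b]) fs); split=> //.
- by rewrite size_map.
- apply/allP => _ /mapP[f /ef /andP[_ /forallP fe] ->]; rewrite /cherry_list /= andbT.
  have E i j : cherry i j -> G (f i) (f j) by move/implyP: (forallP (fe i) j).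
  by rewrite (E a x) // (E x b) // !orbT.
- move=> v y; apply: leq_trans (hf v y) _; apply: sum_hits_count => f _ /forallP fN.
  have := fN a; have := fN x; have := fN b; rewrite !inE /= => vb yx va.
  exact: hits_gt0.
Qed.

Lemma absorbing_cycles k : k = 3 \/ k = 4 -> l <= k < l0 -> exists gs : seq (seq V),
  [/\ size gs = m, all (fun g => (size g == k) && cycle H g) gs, uniq (flatten gs) &
  forall v y, h <= \sum_(g <- gs) hits Ga v y g].
Proof.
move=> k34 kl.
have k3 : 2 < k by case: k34 => ->.
have k4 : k <= 4 by case: k34 => ->.
have [_ _ _ _ [A3 A3']] := Gnpl.
pose x : 'I_k := Ordinal (ltnW k3).
have [//|||fs [sf ef uf hf]] := @absorbers k (cycle_graph k) x (enum 'I_k).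
- exact: enum_uniq.
- move=> Vs dV nV.
  apply: (@density_ratio R p n B k k (1 / 2)%R _ _ (fun i => #|Vs i|)) => //; first by lra.
    apply: A3 => // i; rewrite -natrX; apply: size_quotient; last by rewrite expn_gt0 l0_gt0.
    apply: leq_trans (nV i) _; rewrite leq_mul2r; apply/orP; right.
    by apply: leq_trans B_l0 _; rewrite expnS expn1 leq_pmulr.
  exact: A3'.
exists (map (trace (enum 'I_k)) fs); split=> //.
- by rewrite size_map.
- apply/allP => _ /mapP[f /ef fe ->]; rewrite size_map size_enum_ord eqxx /=.
  have [|cf _] := embedded_cycle _ fe; first exact: ltnW.
  apply: sub_in_cycle cf; last exact/allP.
  by move=> u v _ _ uv; rewrite /= uv orbT.
- move=> v y; apply: leq_trans (hf v y) _; apply: sum_hits_count => f _ /forallP fN.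
  pose a : 'I_k := Ordinal (ltnW (ltnW k3)); pose b : 'I_k := Ordinal k3.
  (* The window that absorbs is the first one, with middle index 1; for k = 4 the fourth vertex
     merely lies in the neighbourhood of v too. *)
  have E : take 3 (enum 'I_k) = [:: a; x; b].
    apply: (@eq_from_nth _ a); rewrite size_take_min size_enum_ord; first exact/minn_idPl.
    move=> i; rewrite leq_min => /andP[i3 ik]; rewrite nth_take //; apply: val_inj.
    by rewrite [LHS]nth_enum_ord //; case: i i3 {ik} => [|[|[|]]].
  rewrite /trace -(cat_take_drop 3 (enum 'I_k)) E.
  have := fN a; have := fN x; have := fN b; rewrite !inE /= => vb yx va.
  exact: hits_gt0.
Qed.

End Absorbers.
End Pseudorandomness.

(** * Proof of the theorem *)

(** The shortest prefix reaching weight [m] overshoots by at most one term. *)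
Lemma prefix_weight (T : eqType) (w : T -> nat) (P : seq T) m L :
  {in P, forall p, w p <= L} -> m <= \sum_(p <- P) w p ->
  exists j, m <= \sum_(p <- take j P) w p <= m + L.
Proof.
elim: P m => [|p P IH] m wL.
  by rewrite big_nil leqn0 => /eqP ->; exists 0.
rewrite big_cons => mS; have wp : w p <= L by apply: wL; rewrite mem_head.
have [mp|pm] := leqP m (w p).
  by exists 1; rewrite /= take0 big_seq1 mp /=; apply: leq_trans wp (leq_addl _ _).
have [||j /andP[j1 j2]] := IH (m - w p).
- by move=> x xP; apply: wL; rewrite inE xP orbT.
- by rewrite leq_subLR.
exists j.+1; rewrite /= big_cons; move: j1 j2 pm; move: (\sum_(_ <- _) _) => S; clear; lia.
Qed.

Lemma mem_zip_sizes (S T : eqType) (P : seq (seq S)) (ts : seq (seq T)) pt :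
  map size P = map size ts -> pt \in zip P ts ->
  [/\ pt.1 \in P, pt.2 \in ts & size pt.1 = size pt.2].
Proof.
elim: P ts => [|p P IH] [|t ts] //= [E1 E2]; rewrite inE => /predU1P[->|/(IH _ E2)[h1 h2 h3]].
  by rewrite !mem_head.
by split=> //; rewrite inE ?h1 ?h2 orbT.
Qed.

Lemma map_size_const (S T : Type) k (P : seq (seq S)) (ts : seq (seq T)) :
  all (fun p => size p == k) P -> all (fun t => size t == k) ts -> size P = size ts ->
  map size P = map size ts.
Proof.
elim: P ts => [|p P IH] [|t ts] //= /andP[/eqP -> aP] /andP[/eqP -> at_] [E].
by rewrite (IH ts).
Qed.

(** For k >= 5 one has k <= 5(k %/ 5) + 4 <= 9(k %/ 5). *)
Lemma size_by_class (S : Type) (P : seq (seq S)) : all (fun p => 3 <= size p) P ->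
  size (flatten P) <= 3 * count (fun p => size p == 3) P +
    4 * count (fun p => size p == 4) P + 9 * \sum_(p <- P | 5 <= size p) size p %/ 5.
Proof.
elim: P => [|p P IH] // /andP[p3 /IH {}IH].
rewrite big_cons [flatten _]/= size_cat; move: IH => /=.
move: (size (flatten P)) (count _ P) (count _ P) (\sum_(_ <- P | _) _) p3 => a b c d p3 IH.
have := divn_eq (size p) 5; have := ltn_pmod (size p) (isT : 0 < 5).
case: (ltnP 4 (size p)) => [p5|p4].
  have : 0 < size p %/ 5 by rewrite divn_gt0.
  by move: IH p5; clear; case: eqP; case: eqP; lia.
by move: IH p3 p4; clear; case: eqP; case: eqP; lia.
Qed.

Section Main.
Variables (R : realType) (n : nat) (p : R) (l0 l : nat) (V W : finType).
Variables (G Ga : sgraph V) (F : sgraph W).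
Hypothesis Gnpl : npl_graph n p l0 l G.
Hypothesis Fdeg : max_degree F <= 2.
Hypothesis Fgirth : girth_at_least F l.
Hypothesis cardW : #|W| = n.
(** [q1], [q] and [q2] are the class sizes for absorbers, for single edges of [G] and for short
    cycles; [s] is the block length, [m0] the least number of absorbers and [h] the hits required
    per pair. With [D] free host vertices a further piece can be placed. *)
Variables (K B q1 q q2 s m0 h D : nat).
Hypothesis n_gt0 : 0 < n.
Hypothesis m0_gt0 : 0 < m0.
Hypothesis Ga_deg : forall v, K <= #|[set y | Ga v y]|.
Hypothesis nB : n <= B * q1.
Hypothesis nq : n <= l0 * q.
Hypothesis nq2 : n <= l0 ^ 2 * q2.
Hypothesis B_l0 : B <= l0.
Hypothesis s_ge5 : 5 <= s.
Hypothesis s_l0 : s <= l0.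
Hypothesis m0_large : 4 * (4 ^ 4 * (4 * B ^ 4)) * h <= m0.
Hypothesis n_h : n ^ 2 <= 2 ^ h.
Hypothesis q1_small : 4 * q1 + 4 * (m0 + l0) <= K.
Hypothesis m0_small : 12 * (m0 + l0) + 2 * q <= K.
Hypothesis D_def : l0 * q2 + 2 * q * s <= D.
Let e0 := 2 * (n %/ l0) + 2 * (n %/ s) + s.
Hypothesis n_m0 : 16 * m0 + e0 <= n.
Hypothesis h_large : 25 * (e0 + D) + 4 * q + 60 <= h.
Let H := gunion Ga G.

Let l0_gt0 : 0 < l0. Proof. by apply: leq_trans s_l0; apply: leq_trans s_ge5. Qed.
Let q_gt0 : 0 < q. Proof. by move: nq; case: q => //; rewrite muln0 leqNgt n_gt0. Qed.

(** As 16 = 3 + 4 + 9, there are [m0] pieces of length 3, or [m0] of length 4, or the longer pieces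
    have room for [m0] cherries. *)
Lemma absorbing_pieces (P : seq (seq W)) : n <= size (flatten P) + e0 ->
  {in P, forall p, 3 <= size p <= l0} ->
  {in P, forall p, size p < 5 -> l <= size p < l0} ->
  exists PT P', [/\ perm_eq P (unzip1 PT ++ P'),
    forall pt, pt \in PT -> size pt.1 = size pt.2 /\ cycle H pt.2,
    uniq (flatten (unzip2 PT)) &
    forall v y, h <= \sum_(pt <- PT) hits Ga v y pt.2].
Proof.
move=> nP P3 Pl.
have zipok (Q Q' : seq (seq W)) (ts : seq (seq V)) : perm_eq P (Q ++ Q') ->
    map size Q = map size ts -> all (cycle H) ts -> uniq (flatten ts) ->
    (forall v y, h <= \sum_(t <- ts) hits Ga v y t) ->
    exists PT P', [/\ perm_eq P (unzip1 PT ++ P'),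
    forall pt, pt \in PT -> size pt.1 = size pt.2 /\ cycle H pt.2,
    uniq (flatten (unzip2 PT)) & forall v y, h <= \sum_(pt <- PT) hits Ga v y pt.2].
  move=> PQ Qt ct ut ht.
  have sQt : size Q = size ts by rewrite -(size_map size Q) Qt size_map.
  exists (zip Q ts), Q'; rewrite unzip1_zip ?sQt // unzip2_zip ?sQt //; split=> //.
    by move=> pt /(mem_zip_sizes Qt)[_ ptt ->]; split=> //; apply: (allP ct).
  by move=> v y; move: (ht v y); rewrite -{1}(@unzip2_zip _ _ Q ts) ?sQt // big_map.
have split_perm (a : pred (seq W)) j : perm_eq P (take j [seq p <- P | a p] ++
    (drop j [seq p <- P | a p] ++ [seq p <- P | ~~ a p])).
  by rewrite catA cat_take_drop perm_sym; apply: permEl; apply: perm_filterC.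
have cycles_case k : k = 3 \/ k = 4 -> m0 <= size [seq p <- P | size p == k] ->
    exists PT P', [/\ perm_eq P (unzip1 PT ++ P'),
    forall pt, pt \in PT -> size pt.1 = size pt.2 /\ cycle H pt.2,
    uniq (flatten (unzip2 PT)) & forall v y, h <= \sum_(pt <- PT) hits Ga v y pt.2].
  move=> k34 mk.
  (* A piece shorter than 5 obeys the length bounds of (A3); one such piece exists because [m0] is
     positive. *)
  have kl : l <= k < l0.
    case E : [seq p <- P | size p == k] mk => [|p' Q]; first by rewrite leqNgt m0_gt0.
    have : p' \in [seq p <- P | size p == k] by rewrite E mem_head.
    rewrite mem_filter => /andP[/eqP <- p'P] _; apply: Pl => //.
    have : p' \in [seq p <- P | size p == k] by rewrite E mem_head.
    by rewrite mem_filter => /andP[/eqP -> _]; case: k34 => ->.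
  have [|gs [sg cg ug hg]] := absorbing_cycles n_gt0 l0_gt0 Gnpl Ga_deg nB _ B_l0 m0_large n_h k34 kl.
    by move: q1_small; clear; lia.
  apply: (zipok (take m0 [seq p <- P | size p == k]) _ gs (split_perm _ _)) => //.
  - apply: (@map_size_const _ _ k).
    + by apply/allP => p' /mem_take; rewrite mem_filter => /andP[].
    + by apply: sub_all cg => g /andP[].
    + by rewrite size_take_min sg; apply/minn_idPl.
  - by apply: sub_all cg => g /andP[].
have [h3|h3] := leqP m0 (size [seq p <- P | size p == 3]); first by apply: (cycles_case 3); auto.
have [h4|h4] := leqP m0 (size [seq p <- P | size p == 4]); first by apply: (cycles_case 4); auto.
pose P5 := [seq p <- P | 5 <= size p].
have h5 : m0 <= \sum_(p <- P5) size p %/ 5.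
  have : size (flatten P) <= 3 * size [seq p <- P | size p == 3] +
      4 * size [seq p <- P | size p == 4] + 9 * \sum_(p <- P5) size p %/ 5.
    rewrite /P5 big_filter !size_filter; apply: size_by_class.
    by apply/allP => p' /P3 /andP[].
  by move: n_m0 nP h3 h4; clear; lia.
(* Only whole pieces can be filled, so up to [l0] additional cherries are used; hence [m0 + l0] in
   the size constraints. *)
have [|j /andP[j1 j2]] := @prefix_weight _ (fun p : seq W => size p %/ 5) P5 m0 l0 _ h5.
  move=> p'; rewrite mem_filter => /andP[_ /P3/andP[_ pl]].
  by apply: leq_trans pl; apply: leq_div.
set m := \sum_(p <- _) _ in j1 j2.
have [||gs [sg cg ug hg]] := absorbing_cherries (m := m) n_gt0 l0_gt0 Gnpl Ga_deg nB _ B_l0 _ n_h.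
- by move: q1_small j2; clear; lia.
- exact: leq_trans m0_large j1.
have all5 : all (leq 5) (map size (take j P5)).
  by apply/allP => _ /mapP[p' /mem_take + ->]; rewrite mem_filter => /andP[].
have s9 : sumn (map size (take j P5)) <= 9 * m.
  rewrite /m sumnE big_map big_distrr /=; rewrite big_seq [X in _ <= X]big_seq.
  apply: leq_sum => p' /mem_take; rewrite mem_filter => /andP[p5 _].
  have := divn_eq (size p') 5; have : 0 < size p' %/ 5 by rewrite divn_gt0.
  by have := ltn_pmod (size p') (isT : 0 < 5); clear; lia.
have sgs : size (flatten gs) = 3 * m.
  rewrite -sg; elim: (gs) cg => //= g gs' IH /andP[/andP[/eqP g3 _] /IH E].
  by rewrite size_cat g3 E mulnS.
have [||ts [sts cts uts _ hts]] := cycles_with_cherries q_gt0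
  (fun X Y dXY qX qY => npl_edge n_gt0 l0_gt0 Gnpl nq dXY qX qY) Ga_deg all5 _ cg ug (fun x xg => xg).
- by rewrite sg /m big_map.
- by rewrite sgs; move: s9 m0_small j2; clear; lia.
apply: (zipok (take j P5) _ ts (split_perm _ _)) => // v y.
exact: leq_trans (hg v y) (hts v y).
Qed.

(** The absorbing pieces are placed first, the others greedily around them. What remains unplaced
    joins the exceptional vertices, and [assembly] finishes. *)
Lemma universal_for_F : contains H F.
Proof.
have cardV : #|V| = n by case: Gnpl.
have G_edge := fun (X Y : {set V}) dXY qX qY => npl_edge n_gt0 l0_gt0 Gnpl nq (X := X) (Y := Y) dXY qX qY.
have s2 : 2 <= s by apply: leq_trans s_ge5.
have [Pc [Po [Ex [uP Pcok Pook ExP sEx]]]] := block_decomposition Fdeg s2 l0_gt0 Fgirth.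
rewrite cardW -/e0 in sEx.
pose ok (p : seq W) (t : seq V) := cycle H t \/ sorted H t /\ {subset ends p <= Ex}.
have Psize p' : p' \in Pc ++ Po -> 3 <= size p' <= l0.
  rewrite mem_cat => /orP[/Pcok[/andP[-> pl] _]|/Pook[-> _]]; first by rewrite ltnW.
  by rewrite s_l0 (leq_trans _ s_ge5).
have Psmall p' : p' \in Pc ++ Po -> size p' < 5 -> l <= size p' < l0.
  rewrite mem_cat => /orP[/Pcok[/andP[_ ->] ->] //|/Pook[-> _]].
  by rewrite ltnNge s_ge5.
have cover : n <= size (flatten (Pc ++ Po)) + e0.
  apply: leq_trans (leq_add (leqnn _) sEx); rewrite -size_cat -cardW cardE.
  apply: uniq_leq_size; first exact: enum_uniq.
  move=> x _; rewrite mem_cat; have [xE|xE] := boolP (x \in Ex); first by rewrite orbT.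
  by have [-> _] := ExP x xE.
have [PT1 [P' [perm1 PT1ok uPT1 hits1]]] := absorbing_pieces cover Psize Psmall.
have sub1 p' : p' \in P' -> p' \in Pc ++ Po.
  by move=> pP; rewrite (perm_mem perm1) mem_cat pP orbT.
have free (U : seq V) : uniq U -> size U + D <= #|V| -> D <= #|~: [set x in U]|.
  move=> uU UD; rewrite cardsCs setCK cardsE (card_uniqP uU).
  by rewrite leq_subRL // (leq_trans _ UD) // leq_addr.
have find p' (U : seq V) : p' \in P' -> uniq U -> size U + D <= #|V| ->
    exists t : seq V, [/\ size t = size p', uniq t, ~~ has (mem U) t & ok p' t].
  move=> pP' uU /(free U uU) DU; have := sub1 p' pP'; rewrite mem_cat => /orP[pPc|pPo].
    have [/andP[p3 pl0] pl] := Pcok p' pPc.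
    have [||t [st ut ct tS]] := npl_cycle n_gt0 l0_gt0 Gnpl p3 _ nq2 (_ : _ <= #|~: [set x in U]|).
    - by rewrite pl.
    - apply: leq_trans DU; apply: leq_trans D_def; apply: leq_trans (leq_addr _ _).
      by rewrite leq_mul2r ltnW ?orbT.
    exists t; split=> //.
      by apply/hasPn => x /tS; rewrite !inE.
    by left; apply: sub_in_cycle ct; [|exact/allP] => u v _ _ uv; rewrite /H /= uv orbT.
  (* A block is embedded as an open path of [G], its ends being exceptional. A path with [s]
     vertices has [s.-1] edges. *)
  have [ps pE] := Pook p' pPo.
  have [|T [qT TS Tp]] := long_path_from q_gt0 G_edge (s := s.-1) (S := ~: [set x in U]).
    rewrite prednK; last by apply: leq_trans s_ge5.
    by apply: leq_trans DU; apply: leq_trans D_def; apply: leq_addl.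
  have /card_gt0P[x xT] : 0 < #|T| by apply: leq_trans qT.
  have [t [st pt ut tS]] := Tp x xT.
  exists (x :: t); split=> //.
  - by rewrite /= st ps prednK // (leq_trans _ s_ge5).
  - by apply/hasPn => z /tS; rewrite !inE.
  - right; split=> //; apply: sub_path pt => u v uv; by rewrite /H /= uv orbT.
have [PT2 [R2 [EP PT2ok uV sR]]] := greedy_pieces (ok := ok) (D := D) find uPT1.
have perm2 : perm_eq (flatten (Pc ++ Po)) (flatten (unzip1 (PT1 ++ PT2)) ++ flatten R2).
  by rewrite -flatten_cat /unzip1 map_cat -catA -[map fst PT2 ++ R2]EP; apply: perm_flatten.
have uW2 : uniq (flatten (unzip1 (PT1 ++ PT2)) ++ flatten R2) by rewrite -(perm_uniq perm2).
have PTok pt : pt \in PT1 ++ PT2 -> size pt.1 = size pt.2 /\ ok pt.1 pt.2.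
  by rewrite mem_cat => /orP[/PT1ok[? ?]|/PT2ok//]; split=> //; left.
have szWV : size (flatten (unzip1 (PT1 ++ PT2))) = size (flatten (unzip2 (PT1 ++ PT2))).
  rewrite !size_flatten /shape -!map_comp; congr sumn; apply/eq_in_map => pt /PTok[] //.
(* Placed vertices are equally many on both sides and the two graphs have the same order, so the
   unplaced vertices fit into the fewer than [D] free host vertices. *)
have R2D : size (flatten R2) <= D.
  have := uniq_size_card uW2; rewrite size_cat szWV /unzip2 map_cat flatten_cat size_cat cardW -cardV.
  case: sR => [-> //|sR'] h1.
  rewrite -(leq_add2l (size (flatten (unzip2 PT1)) + size (flatten (unzip2 PT2)))).
  exact: leq_trans h1 (ltnW sR').
apply: (@assembly W V F Ga G q Fdeg G_edge (PT1 ++ PT2) (Ex ++ flatten R2) h).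
- by rewrite cardW cardV.
- by move: uW2; rewrite cat_uniq => /and3P[].
- by rewrite /unzip2 map_cat flatten_cat.
- move=> x; rewrite mem_cat negb_or => /andP[xE xR].
  have [xP nP] := ExP x xE; split.
    by move: xP; rewrite (perm_mem perm2) mem_cat (negPf xR) orbF.
  move=> p' y pP; apply: nP; rewrite (perm_mem perm1) EP catA mem_cat -[unzip1 _ ++ _]map_cat.
  by rewrite pP.
- move=> pt /PTok[-> [ct|[st sE]]]; split=> //; [by left|right].
  by split=> // x /sE; rewrite mem_cat => ->.
- move=> v y; apply: leq_trans (hits1 v y) _; rewrite big_cat /=; exact: leq_addr.
- by rewrite size_cat; move: h_large sEx R2D; clear; lia.
Qed.

End Main.

(** * Choice of the constants *)

(** With j = h %/ 4, the inequality m < 2^m yields E(h + 1) <= 2^(E + 2 + j), and 2(E + 2 + j) <= h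
    for large h. *)
Lemma exponential_beats_square E : exists h0, forall h, h0 <= h -> (E * h.+1) ^ 2 <= 2 ^ h.
Proof.
exists (4 * (E + 3)) => h hE; pose j := h %/ 4.
have hj : h = j * 4 + h %% 4 by apply: divn_eq.
have h4 : h %% 4 < 4 by rewrite ltn_pmod.
have lt2 m : m < 2 ^ m by apply: ltn_expl.
have le : E * h.+1 <= 2 ^ (E + 2 + j).
  rewrite !expnD -mulnA; apply: leq_mul; first exact: ltnW.
  by have := lt2 j; rewrite -[2 ^ 2]/4; move: hj h4; clear; lia.
apply: (@leq_trans ((2 ^ (E + 2 + j)) ^ 2)); first by rewrite leq_exp2r.
rewrite -expnM; apply: leq_pexp2l => //.
by move: hE hj h4; clear; lia.
Qed.

Lemma constants_arith z K m l h x y (s h0 : nat) : z * 16 <= K -> 400 * m <= K ->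
  h0 + 200 * (s + l + 1) <= h -> h <= m -> x <= y -> 1000 * y <= h ->
  4 * z.+1 + 4 * (m + l) <= K /\ 12 * (m + l) + 2 * x.+1 <= K.
Proof. lia. Qed.

(** All sizes are [n] divided by constants chosen in the order A, B, c, E, s, l0; a large [n0]
    absorbs the rounding. *)
Lemma constants A : 0 < A -> exists l0, 0 < l0 /\ exists n0, forall n, n0 <= n ->
  exists B q1 q q2 s m0 h D,
  [/\ [/\ 0 < n, 0 < m0, n <= B * q1, n <= l0 * q & n <= l0 ^ 2 * q2],
      [/\ B <= l0, 5 <= s & s <= l0],
      [/\ 4 * (4 ^ 4 * (4 * B ^ 4)) * h <= m0, n ^ 2 <= 2 ^ h,
          4 * q1 + 4 * (m0 + l0) <= n %/ A & 12 * (m0 + l0) + 2 * q <= n %/ A],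
      l0 * q2 + 2 * q * s <= D &
      let e0 := 2 * (n %/ l0) + 2 * (n %/ s) + s in
      16 * m0 + e0 <= n /\ 25 * (e0 + D) + 4 * q + 60 <= h].
Proof.
have mul0 a b : 0 < a -> 0 < b -> 0 < a * b by rewrite muln_gt0 => -> ->.
move=> A0; pose B := A * 16; pose c := 4 * (4 ^ 4 * (4 * B ^ 4)).
have B0 : 0 < B by apply: (mul0 _ _).
have c0 : 0 < c by rewrite /c !muln_gt0 A0.
(* [E] makes h = n %/ E so small that m0 = ch is at most K/400. Then [s] and [l0] are so large that
   n/s <= h/200 and s(n/l0) <= h/1000 after rounding down, so that exceptional and leftover vertices
   stay well below [h]. *)
pose E := A * (400 * c); pose s := E * 200; pose l0 := E * (1000 * s).
have E0 : 0 < E by apply: (mul0 _ _) => //; apply: (mul0 _ _).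
have s0 : 0 < s by apply: (mul0 _ _).
have l00 : 0 < l0 by apply: (mul0 _ _) => //; apply: (mul0 _ _).
have [h0 hP] := exponential_beats_square E.
exists l0; split=> //; exists (E * (h0 + 200 * (s + l0 + 1))) => n nE.
pose h := n %/ E; pose K := n %/ A; pose x := n %/ l0; pose y := s * x; pose m0 := c * h.
have hge : h0 + 200 * (s + l0 + 1) <= h by rewrite leq_divRL // mulnC.
have KE : 400 * m0 <= K.
  by rewrite /m0 /h /E divnMA mulnA mulnC leq_trunc_div.
have hm0 : h <= m0 by rewrite leq_pmull.
have zK : n %/ B * 16 <= K by rewrite /B divnMA leq_trunc_div.
have tE : n %/ s * 200 <= h by rewrite /s divnMA leq_trunc_div.
have yE : 1000 * y <= h.
  by rewrite /y /x /l0 divnMA mulnA mulnC leq_trunc_div.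
have xy : x <= y by rewrite leq_pmull.
have x2 : l0 * (n %/ l0 ^ 2) <= x by rewrite expnS expn1 divnMA mulnC leq_trunc_div.
have Kn : K <= n by apply: leq_div.
have up d : 0 < d -> n <= d * (n %/ d).+1 by move=> d0; rewrite mulnC ltnW // ltn_ceil.
have Bl0 : B <= l0.
  have BE : B <= E by rewrite leq_mul2l; apply/orP; right; clear -c0; lia.
  by apply: leq_trans BE (leq_pmulr _ _); apply: (mul0 _ _).
have s5 : 5 <= s by rewrite /s; clear -E0; lia.
have sl0 : s <= l0.
  by apply: leq_trans (leq_pmull _ E0); rewrite leq_pmull.
exists B, (n %/ B).+1, x.+1, (n %/ l0 ^ 2).+1, s, m0, h, (l0 * (n %/ l0 ^ 2).+1 + 2 * x.+1 * s).
have Dle : l0 * (n %/ l0 ^ 2).+1 + 2 * x.+1 * s <= x + l0 + 2 * y + 2 * s.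
  have -> : 2 * x.+1 * s = 2 * y + 2 * s by rewrite /y mulnS mulnDl addnC -mulnA [x * s]mulnC.
  by rewrite mulnS; move: x2; clear; lia.
have final : 25 * (2 * x + 2 * (n %/ s) + s + (l0 * (n %/ l0 ^ 2).+1 + 2 * x.+1 * s)) +
    4 * x.+1 + 60 <= h.
  move: Dle; move: (l0 * _ + _) (n %/ s) tE => D t tE Dle.
  by move: hge yE xy; move: Dle tE; clear; lia.
split=> //.
- split; [|by apply: (mul0 _ _) => //; clear -hge; lia|exact: up|exact: up|by apply: up; rewrite expn_gt0 l00].
  by move: Kn KE hm0 hge; clear; lia.
- split=> //.
  + apply: leq_trans (hP h _); last by move: hge; clear; lia.
    by rewrite leq_exp2r // up.
  + by have [] := constants_arith zK KE hge hm0 xy yE.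
  + by have [] := constants_arith zK KE hge hm0 xy yE.
- move=> e0; split=> //.
  have e0h : e0 <= h.
    apply: leq_trans final; rewrite -addnA; apply: leq_trans (leq_addr _ _).
    by apply: leq_trans (leq_pmull _ _); rewrite // leq_addr.
  have a1 (a b d k m : nat) : a <= b -> b <= d -> 400 * d <= k -> k <= m -> 16 * d + a <= m.
    by clear; lia.
  exact: a1 e0h hm0 KE Kn.
Qed.

Lemma min_degree_le (V : finType) (G : sgraph V) v : min_degree G <= degree G v.
Proof.
have : v \in index_enum V by apply: mem_index_enum.
rewrite /min_degree; elim: (index_enum V) => //= w s IH.
rewrite inE big_cons => /predU1P[->|/IH]; first exact: geq_minl.
exact: leq_trans (geq_minr _ _).
Qed.

Unset Implicit Arguments.
Set Printing Implicit Defensive.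
Local Open Scope ring_scope.

Theorem theorem2p3 (R : realType) (alpha : R) (halpha : 0 < alpha) :
  exists l0 : nat, (0 < l0)%N /\
  forall p : nat -> R, exists n0 : nat,
  forall l : nat, (3 <= l)%N -> little_omega p (p_threshold R l0 l) ->
  forall n : nat, (n0 <= n)%N ->
  forall (V : finType) (G Galpha : sgraph V),
    npl_graph n (p n) l0 l G ->
    alpha * n%:R <= (min_degree Galpha)%:R ->
    family_universal l n (gunion Galpha G).
Proof.
(* An integer above 1/alpha, so that minimum degree alpha n gives every vertex at least n %/ A
   neighbours. *)
pose A := (Num.bound alpha^-1).+1.
have [l0 [l00 [n0 hn0]]] := @constants A isT.
exists l0; split=> // p; exists n0 => l _ _ n nn0 V G Ga Gnpl Gdeg W F [cW Fdeg Fg].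
have [B [q1 [q [q2 [s [m0 [h [D [[h1 h2 h3 h4 h5] [h6 h7 h8] [h9 h10 h11 h12] h13 [h14 h15]]]]]]]]]] := hn0 n nn0.
have degA v : (n %/ A <= #|[set y | Ga v y]|)%N.
  rewrite -ltnS ltn_divLR // -(ltr_nat R).
  have : alpha * n%:R <= #|[set y | Ga v y]|%:R.
    by apply: le_trans Gdeg _; rewrite ler_nat; apply: (min_degree_le Ga v).
  rewrite -ler_pdivlMl // => hd; apply: le_lt_trans hd _.
  rewrite mulrC natrM; apply: ltr_pM => //.
  - by rewrite invr_ge0 ltW.
  - by rewrite ltr_nat.
  - apply: lt_trans (archi_boundP _) _; first by rewrite invr_ge0 ltW.
    by rewrite ltr_nat.
exact: (universal_for_F Gnpl Fdeg Fg cW h1 h2 degA h3 h4 h5 h6 h7 h8 h9 h10 h11 h12 h13 h14 h15).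
Qed.
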